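(* Let $\langle R,\sim\rangle$ be the Rado graph, $\kappa$ an infinite cardinal and $G$ a $\mathbb P(R)$-generic filter over the ground model $V$. If $x\in V_{\mathbb P(R)}[G]$ and $x:\omega\to\kappa$, then $x\in V[\rho_G]$, where $\rho_G=\{p\in R:R^{\{p\}}_{\{p\}}\in G\}$.
   Context: The Rado graph $\langle R,\sim\rangle$ is the unique countable graph such that $R^H_K\neq\emptyset$ for all finite $K\subset H\subset R$, where $R^H_K=\{v\in R\setminus H:\forall k\in K\,(v\sim k)\wedge\forall h\in H\setminus K\,(v\not\sim h)\}$ (so $R^{\{p\}}_{\{p\}}$ is the set of neighbours of $p$). $\mathbb P(R)$ is the set of subsets of $R$ whose induced subgraph is isomorphic to $R$, used as a forcing notion ordered by inclusion. $V[\rho_G]$ is the smallest model of ZFC containing $V$ and $\rho_G$. *)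

(* Defs.v *)
Set Implicit Arguments.
Unset Strict Implicit.
Unset Printing Implicit Defensive.

(* The ambient universe of sets, in which the ground model, the generic filter
   and the generic extension live: well-founded, with the axioms of set theory
   in their second-order form.  Models of first-order ZFC are classes of it. *)
Record universe := Universe {
  sort :> Type;
  mem : sort -> sort -> Prop;
  upair : sort -> sort -> sort;
  bigcup : sort -> sort;
  pow : sort -> sort;
  sep : sort -> (sort -> Prop) -> sort;
  infset : sort;
  mem_ext : forall x y, (forall z, mem z x <-> mem z y) -> x = y;
  mem_wf : well_founded mem;
  mem_upair : forall x y z, mem z (upair x y) <-> z = x \/ z = y;
  mem_bigcup : forall a z, mem z (bigcup a) <-> exists y, mem y a /\ mem z y;
  mem_pow : forall a z, mem z (pow a) <-> forall w, mem w z -> mem w a;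
  mem_sep : forall a p z, mem z (sep a p) <-> mem z a /\ p z;
  mem_repl : forall a (F : sort -> sort -> Prop),
    (forall x y y', mem x a -> F x y -> F x y' -> y = y') ->
    exists b, forall y, mem y b <-> exists x, mem x a /\ F x y;
  infset0 : exists e, mem e infset /\ forall z, ~ mem z e;
  infsetS : forall y, mem y infset ->
    exists s, mem s infset /\ forall z, mem z s <-> mem z y \/ z = y
}.

Arguments mem {u} _ _.
Arguments upair {u} _ _.
Arguments bigcup {u} _.
Arguments pow {u} _.
Arguments sep {u} _ _.
Arguments infset {u}.

Declare Scope universe_scope.
Delimit Scope universe_scope with U.
Open Scope universe_scope.

Notation "x ∈ y" := (mem x y) (at level 70) : universe_scope.
Notation "x ∉ y" := (~ mem x y) (at level 70) : universe_scope.

Section BasicSetTheory.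
Context {U : universe}.
Implicit Types (x y z a b f n : U).

Definition subset a b := forall z, z ∈ a -> z ∈ b.

Definition sing x : U := upair x x.
Definition opair x y : U := upair (sing x) (upair x y).

Definition is_function f a b :=
  (forall z, z ∈ f -> exists x y, x ∈ a /\ y ∈ b /\ z = opair x y) /\
  (forall x, x ∈ a -> exists! y, opair x y ∈ f).

Definition is_injection f a b :=
  is_function f a b /\
  forall x x' y, opair x y ∈ f -> opair x' y ∈ f -> x = x'.

Definition is_bijection f a b :=
  is_injection f a b /\ forall y, y ∈ b -> exists x, opair x y ∈ f.

Definition is_inductive a :=
  (exists e, e ∈ a /\ forall z, z ∉ e) /\
  (forall y, y ∈ a -> exists s, s ∈ a /\ forall z, z ∈ s <-> z ∈ y \/ z = y).

Definition omega : U := sep infset (fun n => forall a, is_inductive a -> n ∈ a).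

Definition is_finite a := exists n f, n ∈ omega /\ is_bijection f n a.

Definition is_ordinal a :=
  (forall y, y ∈ a -> subset y a) /\
  (forall y, y ∈ a -> forall z, z ∈ y -> subset z y).

End BasicSetTheory.

(* First-order formulas of set theory, with de Bruijn indices. *)
Inductive form : Type :=
| Fmem (i j : nat)
| Feq (i j : nat)
| Fimp (p q : form)
| Fneg (p : form)
| Fall (p : form).

Definition scons (A : Type) (x : A) (e : nat -> A) (i : nat) : A :=
  match i with O => x | S k => e k end.

Section Models.
Context {U : universe}.
Implicit Types (M N : U -> Prop) (e : nat -> U).

Fixpoint sat M (p : form) e : Prop :=
  match p with
  | Fmem i j => e i ∈ e j
  | Feq i j => e i = e j
  | Fimp p q => sat M p e -> sat M q e
  | Fneg p => ~ sat M p e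
  | Fall p => forall x, M x -> sat M p (scons x e)
  end.

(* Each single axiom is its relativization to M; the two schemes range over all
   first-order formulas with parameters e from M. *)
Record ZFC_model M : Prop := {
  ZFC_extensionality : forall x y, M x -> M y ->
    (forall z, M z -> (z ∈ x <-> z ∈ y)) -> x = y;
  ZFC_foundation : forall x, M x -> (exists y, M y /\ y ∈ x) ->
    exists y, M y /\ y ∈ x /\ ~ (exists z, M z /\ z ∈ x /\ z ∈ y);
  ZFC_pairing : forall x y, M x -> M y -> exists a, M a /\ x ∈ a /\ y ∈ a;
  ZFC_union : forall a, M a -> exists b, M b /\
    forall y z, M y -> M z -> y ∈ a -> z ∈ y -> z ∈ b;
  ZFC_power : forall a, M a -> exists b, M b /\
    forall z, M z -> (forall w, M w -> w ∈ z -> w ∈ a) -> z ∈ b;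
  ZFC_infinity : exists a, M a /\
    (exists o, M o /\ o ∈ a /\ forall z, M z -> z ∉ o) /\
    (forall y, M y -> y ∈ a ->
       exists s, M s /\ s ∈ a /\ forall z, M z -> (z ∈ s <-> z ∈ y \/ z = y));
  ZFC_separation : forall p e a, (forall i, M (e i)) -> M a ->
    exists b, M b /\
      forall z, M z -> (z ∈ b <-> z ∈ a /\ sat M p (scons z e));
  ZFC_replacement : forall p e a, (forall i, M (e i)) -> M a ->
    (forall x, M x -> x ∈ a ->
       exists! y, M y /\ sat M p (scons y (scons x e))) ->
    exists b, M b /\ forall x, M x -> x ∈ a ->
      exists y, M y /\ y ∈ b /\ sat M p (scons y (scons x e));
  ZFC_choice : forall a, M a ->
    (forall y, M y -> y ∈ a -> exists z, M z /\ z ∈ y) ->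
    (forall y y' z, M y -> M y' -> M z ->
       y ∈ a -> y' ∈ a -> z ∈ y -> z ∈ y' -> y = y') ->
    exists c, M c /\ forall y, M y -> y ∈ a -> exists! z, M z /\ z ∈ y /\ z ∈ c
}.

Definition transitive_class M := forall x y, M x -> y ∈ x -> M y.

(* M may be a set (such as a countable transitive model) or a proper class. *)
Definition transitive_model M := transitive_class M /\ ZFC_model M.

(* "k is an infinite cardinal" in the sense of M. *)
Definition is_infinite_cardinal M (k : U) :=
  M k /\ is_ordinal k /\ subset omega k /\
  forall a, a ∈ k -> ~ (exists f, M f /\ is_bijection f a k).

(* M[a], the smallest transitive model of ZFC that includes M and has a as an
   element, given as the class of all sets that belong to every such model. *)
Definition adjoin M (a x : U) : Prop :=
  forall N, transitive_model N -> (forall y, M y -> N y) -> N a -> N x.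

End Models.

Section Forcing.
Context {U : universe}.
Implicit Types (M : U -> Prop) (P G : U) (le : U -> U -> Prop).

Definition is_dense P le (D : U) :=
  subset D P /\ forall p, p ∈ P -> exists d, d ∈ D /\ le d p.

Record is_filter P le G : Prop := {
  filter_sub : subset G P;
  filter_nonempty : exists p, p ∈ G;
  filter_up : forall p q, p ∈ G -> q ∈ P -> le p q -> q ∈ G;
  filter_dir : forall p q, p ∈ G -> q ∈ G -> exists r, r ∈ G /\ le r p /\ le r q
}.

Definition is_generic M P le G :=
  is_filter P le G /\
  forall D, M D -> is_dense P le D -> exists p, p ∈ D /\ p ∈ G.

Inductive is_name P : U -> Prop :=
| IsName t :
    (forall z, z ∈ t -> exists s p, p ∈ P /\ z = opair s p /\ is_name P s) ->
    is_name P t.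

(* Graph of the evaluation of names,
   val_G(t) = { val_G(s) : there is p in G with (s, p) in t }. *)
Inductive is_val G : U -> U -> Prop :=
| IsVal t x :
    (forall y, y ∈ x -> exists s p, p ∈ G /\ opair s p ∈ t /\ is_val G s y) ->
    (forall s p, p ∈ G -> opair s p ∈ t -> exists y, y ∈ x /\ is_val G s y) ->
    is_val G t x.

(* The generic extension M_P[G]. *)
Definition gen_ext M P G (x : U) : Prop :=
  exists t, M t /\ is_name P t /\ is_val G t x.

End Forcing.

Section RadoGraph.
Context {U : universe}.
Implicit Types (M : U -> Prop) (R E H K A G : U).

(* A graph is a vertex set R with its edge relation E, a set of ordered pairs. *)
Record is_graph R E : Prop := {
  graph_edges : forall z, z ∈ E -> exists u v, u ∈ R /\ v ∈ R /\ z = opair u v;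
  graph_irrefl : forall v, opair v v ∉ E;
  graph_sym : forall u v, opair u v ∈ E -> opair v u ∈ E
}.

(* R^H_K *)
Definition rado_set R E H K : U :=
  sep R (fun v => v ∉ H /\ (forall k, k ∈ K -> opair v k ∈ E) /\
                  (forall h, h ∈ H -> h ∉ K -> opair v h ∉ E)).

(* "<R, E> is the Rado graph" in the sense of M: the witness of countability is
   required to be in M; finiteness is absolute for transitive models. *)
Record is_rado M R E : Prop := {
  rado_vertices : M R;
  rado_edges : M E;
  rado_graph : is_graph R E;
  rado_countable : exists f, M f /\ is_injection f R omega;
  rado_extension : forall H K, is_finite H -> subset H R -> subset K H ->
    exists v, v ∈ rado_set R E H K
}.

(* f is an isomorphism from the subgraph induced on A onto <R, E>. *)
Definition is_iso_onto R E A (f : U) :=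
  is_bijection f A R /\
  forall u v u' v', opair u u' ∈ f -> opair v v' ∈ f ->
    (opair u v ∈ E <-> opair u' v' ∈ E).

(* The poset P(R) as computed in M. *)
Definition copies M R E : U :=
  sep (pow R) (fun A => M A /\ exists f, M f /\ is_iso_onto R E A f).

Definition rho R E G : U :=
  sep R (fun p => rado_set R E (sing p) (sing p) ∈ G).

End RadoGraph.

(* Main.v *)
From Stdlib Require Import List Arith Lia Classical ClassicalEpsilon Wellfounded Relations.
Require Import Defs.

(* Below every copy A of R there is, by fusion, a copy B such that each value
   x(n) is decided by the type of the generic over a finite subset F of R, that
   is, by F ∩ rho_G; some such B lies in G.  The difficulty of the fusion is that
   shrinking the part of B of one type over F to decide x(n) may ruin its
   interaction with the parts of the other types.  This is avoided by keeping all
   types over F twinned: the available vertices carry labels in R so that every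
   type uses every label once and adjacency of vertices with distinct labels is
   read off the labels.  Shrinking one type shrinks the set of labels, hence all
   the types alike.  When a vertex b with label i is added to F, every type splits
   in two according to adjacency to b, that is, according to adjacency of the
   label to i; the twinning is restored by relabelling along a family of pairs of
   vertices of R, one adjacent to i and the other not, that are twinned among
   themselves. *)

Set Implicit Arguments.
Unset Strict Implicit.
Unset Printing Implicit Defensive.

(** * Definability over a transitive model *)

(** The models satisfy first-order ZFC inside a larger universe, so every set built during the
    fusion has to be separated by a formula. This is why definability is treated as a closure
    property of predicates, and why recursions in M keep the finiteness of their approximations,
    witnessed by lists of the metatheory, apart from the definable step relation. A stage has a
    finite range F, hence finitely many types, and finitely many shrinkings decide x(n) for all of
    them. Vertices added later come from the remaining pool, so a copy inside B that avoids F and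
    has one type over F lies in the part treated for that type. The generic supplies such a copy:
    copies are indivisible, so densely many conditions lie inside or outside the neighbourhood of a
    given b, and the side chosen by G tells whether b is in rho_G. As F ∩ rho_G is finite it belongs
    to V, and so does the table of decided values; x is computed from the table and rho_G in every
    transitive model of ZFC that includes V and contains rho_G. *)

Section Renaming.
Context {U : universe}.
Implicit Types (M : U -> Prop) (e c : nat -> U).

Definition up (r : nat -> nat) (i : nat) : nat :=
  match i with O => O | S k => S (r k) end.

Fixpoint ren (r : nat -> nat) (p : form) : form :=
  match p with
  | Fmem i j => Fmem (r i) (r j)
  | Feq i j => Feq (r i) (r j)
  | Fimp p q => Fimp (ren r p) (ren r q)
  | Fneg p => Fneg (ren r p)
  | Fall p => Fall (ren (up r) p)
  end.

Lemma sat_ren M p : forall r e e', (forall i, e (r i) = e' i) ->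
  sat M (ren r p) e <-> sat M p e'.
Proof.
  induction p as [i j|i j|p IHp q IHq|p IHp|p IHp]; intros r e e' H; simpl.
  - now rewrite !H.
  - now rewrite !H.
  - now rewrite (IHp _ _ _ H), (IHq _ _ _ H).
  - now rewrite (IHp _ _ _ H).
  - split; intros HA x Hx; generalize (HA x Hx);
      apply IHp; intros [|i]; simpl; auto.
Qed.

Lemma parity_cases i : exists k, i = 2 * k \/ i = 2 * k + 1.
Proof.
  destruct (Nat.Even_or_Odd i) as [[k H]|[k H]]; exists k; auto.
Qed.

Definition on_parity (A : Type) (f g : nat -> A) (i : nat) : A :=
  if Nat.even i then f (Nat.div2 i) else g (Nat.div2 i).

Lemma on_parity_even A (f g : nat -> A) k : on_parity f g (2 * k) = f k.
Proof. unfold on_parity. now rewrite Nat.even_even, Nat.div2_double. Qed.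

Lemma on_parity_odd A (f g : nat -> A) k : on_parity f g (2 * k + 1) = g k.
Proof.
  unfold on_parity. rewrite Nat.even_odd.
  now rewrite Nat.add_1_r, Nat.div2_succ_double.
Qed.

(* Even indices read the variables, odd ones the parameters. *)
Definition join e c : nat -> U := on_parity e c.

Lemma join_even e c k : join e c (2 * k) = e k.
Proof. apply on_parity_even. Qed.

Lemma join_odd e c k : join e c (2 * k + 1) = c k.
Proof. apply on_parity_odd. Qed.

End Renaming.

Section Definability.
Context {U : universe} (M : U -> Prop) (HM : transitive_model M).
Implicit Types (e : nat -> U).

Definition valid e := forall i, M (e i).

(** Interleaving an infinite parameter sequence with the variables spares any bound on the free
    variables. Later constructions combine closure properties of [df] and never write out a
    formula. *)
Definition df (phi : (nat -> U) -> Prop) : Prop :=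
  exists p c, valid c /\ forall e, valid e -> (phi e <-> sat M p (join e c)).

Definition dft (t : (nat -> U) -> U) : Prop :=
  (forall e, valid e -> M (t e)) /\ df (fun e => e 0 = t (fun i => e (S i))).

Lemma M_trans x y : M x -> y ∈ x -> M y.
Proof. intros. eapply (proj1 HM); eauto. Qed.

Lemma valid_scons x e : M x -> valid e -> valid (scons x e).
Proof. intros Hx He [|i]; simpl; auto. Qed.

Lemma M_inhabited : exists x, M x.
Proof. destruct (ZFC_infinity (proj2 HM)) as [a [Ha _]]. eauto. Qed.

Lemma df_ext phi psi : (forall e, valid e -> (phi e <-> psi e)) -> df phi -> df psi.
Proof.
  intros H [p [c [Hc Hp]]]. exists p, c. split; auto.
  intros e He. now rewrite <- H, Hp.
Qed.

Lemma df_ren r phi : df phi -> df (fun e => phi (fun i => e (r i))).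
Proof.
  intros [p [c [Hc Hp]]].
  exists (ren (on_parity (fun k => 2 * r k) (fun k => 2 * k + 1)) p), c.
  split; auto. intros e He. rewrite Hp by (intro; apply He).
  symmetry. apply sat_ren. intros i.
  destruct (parity_cases i) as [k [->| ->]].
  - rewrite on_parity_even. cbv beta. now rewrite !join_even.
  - rewrite on_parity_odd. cbv beta. now rewrite !join_odd.
Qed.

(** The two parameter sequences are interleaved once more: among the common parameters, those of [p]
    come at the even places and those of [q] at the odd ones. *)
Lemma df_common phi psi : df phi -> df psi -> exists p q c, valid c /\
  forall e, valid e -> (phi e <-> sat M p (join e c)) /\ (psi e <-> sat M q (join e c)).
Proof.
  intros [p [c [Hc Hp]]] [q [d [Hd Hq]]].
  exists (ren (on_parity (fun k => 2 * k) (fun k => 2 * (2 * k) + 1)) p),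
    (ren (on_parity (fun k => 2 * k) (fun k => 2 * (2 * k + 1) + 1)) q), (join c d).
  split.
  - intros i. destruct (parity_cases i) as [k [->| ->]].
    + rewrite join_even; auto.
    + rewrite join_odd; auto.
  - intros e He. rewrite Hp, Hq by auto. split; symmetry; apply sat_ren; intros i;
    destruct (parity_cases i) as [k [->| ->]];
    rewrite ?on_parity_even, ?on_parity_odd; cbv beta; rewrite ?join_odd, ?join_even, ?join_odd; auto.
Qed.

Lemma df_imp phi psi : df phi -> df psi -> df (fun e => phi e -> psi e).
Proof.
  intros H1 H2. destruct (df_common H1 H2) as [p [q [c [Hc H]]]].
  exists (Fimp p q), c. split; auto. intros e He. simpl.
  destruct (H e He). tauto.
Qed.

Lemma df_not phi : df phi -> df (fun e => ~ phi e).
Proof.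
  intros [p [c [Hc Hp]]]. exists (Fneg p), c. split; auto.
  intros e He. simpl. now rewrite Hp.
Qed.

Lemma df_and phi psi : df phi -> df psi -> df (fun e => phi e /\ psi e).
Proof.
  intros H1 H2. apply df_ext with (fun e => ~ (phi e -> ~ psi e)).
  - intros. tauto.
  - apply df_not, df_imp; auto. now apply df_not.
Qed.

Lemma df_or phi psi : df phi -> df psi -> df (fun e => phi e \/ psi e).
Proof.
  intros H1 H2. apply df_ext with (fun e => ~ phi e -> psi e).
  - intros. tauto.
  - apply df_imp; auto. now apply df_not.
Qed.

Lemma df_iff phi psi : df phi -> df psi -> df (fun e => phi e <-> psi e).
Proof. intros. unfold iff. apply df_and; now apply df_imp. Qed.

Lemma df_all (phi : U -> (nat -> U) -> Prop) :
  df (fun e => phi (e 0) (fun i => e (S i))) -> df (fun e => forall x, M x -> phi x e).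
Proof.
  intros [p [c [Hc Hp]]].
  (* Under the quantifier the bound variable takes place 0, so [e j] moves to place [2 * j + 1] and
     parameter [c k] to place [2 * k + 2]: the parities are exchanged. *)
  set (r := on_parity (fun k => match k with O => O | S j => S (2 * j) end)
                      (fun k => S (2 * k + 1))).
  exists (Fall (ren r p)), c.
  split; auto. intros e He. simpl.
  assert (A : forall x, M x -> (phi x e <-> sat M (ren r p) (scons x (join e c)))).
  { intros x Hx. etransitivity; [exact (Hp (scons x e) (valid_scons Hx He))|].
    symmetry. apply sat_ren. intros i. unfold r.
    destruct (parity_cases i) as [k [->| ->]].
    - rewrite join_even, on_parity_even. destruct k as [|k]; [reflexivity|].
      exact (join_even e c k).
    - rewrite join_odd, on_parity_odd. exact (join_odd e c k). }
  split; intros H x Hx; apply A; auto.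
Qed.

Lemma df_ex (phi : U -> (nat -> U) -> Prop) :
  df (fun e => phi (e 0) (fun i => e (S i))) -> df (fun e => exists x, M x /\ phi x e).
Proof.
  intros H. apply df_ext with (fun e => ~ forall x, M x -> ~ phi x e).
  - intros e He. split.
    + intros H1. apply NNPP. intros H2. apply H1. intros x Hx Hp. eauto.
    + intros [x [Hx Hp]] H1. eapply H1; eauto.
  - apply df_not. apply df_all with (phi := fun x e => ~ phi x e). now apply df_not.
Qed.

Lemma df_var_mem i j : df (fun e => e i ∈ e j).
Proof.
  destruct M_inhabited as [c Hc].
  exists (Fmem (2 * i) (2 * j)), (fun _ => c). split; [intro; auto|].
  intros e He. cbn [sat]. now rewrite !join_even.
Qed.

Lemma df_var_eq i j : df (fun e => e i = e j).
Proof.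
  destruct M_inhabited as [c Hc].
  exists (Feq (2 * i) (2 * j)), (fun _ => c). split; [intro; auto|].
  intros e He. cbn [sat]. now rewrite !join_even.
Qed.

(** By excluded middle a proposition free of the variables is defined by a trivially true or a
    trivially false formula, however far it is from being expressible in M. This lets arbitrary
    conditions on single vertices of a list occur in definitions. *)
Lemma df_cst (A : Prop) : df (fun _ => A).
Proof.
  destruct (classic A) as [HA|HA].
  - apply df_ext with (fun e => e 0 = e 0); [tauto|apply df_var_eq].
  - apply df_ext with (fun e => ~ e 0 = e 0); [tauto|apply df_not, df_var_eq].
Qed.

Lemma dft_var k : dft (fun e => e k).
Proof. split; auto. apply df_var_eq. Qed.

Lemma dft_cst (a : U) : M a -> dft (fun _ => a).
Proof.
  intros Hc. split; auto.
  exists (Feq (2 * 0) (2 * 0 + 1)), (fun _ => a). split; [intro; auto|].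
  intros e He. cbn [sat]. now rewrite join_even, join_odd.
Qed.

Lemma dft_ren r t : dft t -> dft (fun e => t (fun i => e (r i))).
Proof.
  intros [H1 H2]. split.
  - intros e He. apply H1. intro; apply He.
  - exact (df_ren (up r) H2).
Qed.

Lemma df_subst t (phi : U -> (nat -> U) -> Prop) : dft t ->
  df (fun e => phi (e 0) (fun i => e (S i))) -> df (fun e => phi (t e) e).
Proof.
  intros [H1 H2] H.
  apply df_ext with (fun e => exists x, M x /\ (x = t e /\ phi x e)).
  - intros e He. split.
    + intros [x [_ [-> Hx]]]. auto.
    + intros Hx. exists (t e). auto.
  - apply df_ex with (phi := fun x e => x = t e /\ phi x e). now apply df_and.
Qed.

Lemma df_app1 (P : U -> Prop) t : df (fun e => P (e 0)) -> dft t -> df (fun e => P (t e)).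
Proof.
  intros HP Ht. apply df_subst with (t := t) (phi := fun x e => P x); auto.
Qed.

Lemma dft_shift t : dft t -> dft (fun e => t (fun i => e (S i))).
Proof. exact (@dft_ren S t). Qed.

Lemma df_app2 (P : U -> U -> Prop) s t : df (fun e => P (e 0) (e 1)) ->
  dft s -> dft t -> df (fun e => P (s e) (t e)).
Proof.
  intros HP Hs Ht. apply df_subst with (t := s) (phi := fun x e => P x (t e)); auto.
  apply df_subst with (t := fun e => t (fun i => e (S i))) (phi := fun x e => P (e 0) x).
  - now apply dft_shift.
  - exact (df_ren (fun i => match i with O => 1 | _ => 0 end) HP).
Qed.

Lemma df_app3 (P : U -> U -> U -> Prop) r s t : df (fun e => P (e 0) (e 1) (e 2)) ->
  dft r -> dft s -> dft t -> df (fun e => P (r e) (s e) (t e)).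
Proof.
  intros HP Hr Hs Ht. apply df_subst with (t := r) (phi := fun x e => P x (s e) (t e)); auto.
  apply df_subst with (t := fun e => s (fun i => e (S i)))
    (phi := fun x e => P (e 0) x (t (fun i => e (S i)))).
  - now apply dft_shift.
  - apply df_subst with (t := fun e => t (fun i => e (S (S i))))
      (phi := fun x e => P (e 1) (e 0) x).
    + apply (dft_ren (fun i => S (S i)) Ht).
    + exact (df_ren (fun i => match i with O => 2 | S O => 1 | _ => 0 end) HP).
Qed.

Lemma df_mem s t : dft s -> dft t -> df (fun e => s e ∈ t e).
Proof.
  intros Hs Ht.
  apply df_subst with (t := s) (phi := fun x e => x ∈ t e); auto.
  apply df_subst with (t := fun e => t (fun i => e (S i))) (phi := fun x e => e 0 ∈ x).
  - now apply dft_shift.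
  - apply (df_var_mem 1 0).
Qed.

Lemma df_eq s t : dft s -> dft t -> df (fun e => s e = t e).
Proof.
  intros Hs Ht.
  apply df_subst with (t := s) (phi := fun x e => x = t e); auto.
  apply df_subst with (t := fun e => t (fun i => e (S i))) (phi := fun x e => e 0 = x).
  - now apply dft_shift.
  - apply (df_var_eq 1 0).
Qed.

(** Transitivity puts every element of [s e] into M, so a bounded quantifier needs no
    relativization. *)
Lemma df_ball s (phi : U -> (nat -> U) -> Prop) : dft s ->
  df (fun e => phi (e 0) (fun i => e (S i))) -> df (fun e => forall x, x ∈ s e -> phi x e).
Proof.
  intros Hs H. apply df_ext with (fun e => forall x, M x -> x ∈ s e -> phi x e).
  - intros e He. split; intros H1 x; [|auto]. intros Hx.
    apply H1; auto. apply M_trans with (s e); auto. now apply (proj1 Hs).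
  - apply df_all with (phi := fun x e => x ∈ s e -> phi x e). apply df_imp; auto.
    apply df_mem; [apply dft_var|now apply dft_shift].
Qed.

Lemma df_bex s (phi : U -> (nat -> U) -> Prop) : dft s ->
  df (fun e => phi (e 0) (fun i => e (S i))) -> df (fun e => exists x, x ∈ s e /\ phi x e).
Proof.
  intros Hs H. apply df_ext with (fun e => exists x, M x /\ (x ∈ s e /\ phi x e)).
  - intros e He. split; [intros [x [_ Hx]]; eauto|]. intros [x [H1 H2]].
    exists x. split; auto. apply M_trans with (s e); auto. now apply (proj1 Hs).
  - apply df_ex with (phi := fun x e => x ∈ s e /\ phi x e). apply df_and; auto.
    apply df_mem; [apply dft_var|now apply dft_shift].
Qed.

Lemma dft_ext t : (forall e, valid e -> M (t e)) ->
  df (fun e => e 0 ∈ t (fun i => e (S i))) -> dft t.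
Proof.
  intros H1 H2. split; auto.
  apply df_ext with (fun e => forall z, M z -> (z ∈ e 0 <-> z ∈ t (fun i => e (S i)))).
  - intros e He. split; [|now intros ->]. intros H.
    apply (ZFC_extensionality (proj2 HM)); auto. apply H1. intro; apply He.
  - apply df_all with (phi := fun z e => z ∈ e 0 <-> z ∈ t (fun i => e (S i))).
    apply df_iff; [apply (df_var_mem 0 1)|]. exact (df_ren (fun i => match i with O => O | S k => S (S k) end) H2).
Qed.

Lemma M_sep a P : M a -> df (fun e => P (e 0)) -> M (sep a P).
Proof.
  intros Ha [p [c [Hc Hp]]].
  (* [P] looks at variable 0 only, so all variables are read as the element being tested, and the
     parameters follow it unchanged. *)
  set (r := on_parity (fun _ => 0) S).
  destruct (@ZFC_separation _ M (proj2 HM) (ren r p) c a Hc Ha) as [b [Hb H]].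
  replace (sep a P) with b; auto. apply mem_ext. intros z.
  rewrite mem_sep.
  assert (E : M z -> (sat M (ren r p) (scons z c) <-> P z)).
  { intros Hz. rewrite (Hp (fun _ => z) (fun _ => Hz)). apply sat_ren. intros i. unfold r.
    destruct (parity_cases i) as [k [->| ->]].
    - now rewrite join_even, on_parity_even.
    - now rewrite join_odd, on_parity_odd. }
  split.
  - intros Hz. pose proof (M_trans Hb Hz) as Mz.
    destruct (proj1 (H z Mz) Hz). split; auto. now apply E.
  - intros [Hz HPz]. pose proof (M_trans Ha Hz) as Mz.
    apply H; auto. split; auto. now apply E.
Qed.

(** Replacement in M yields only a superset of the image, which Separation then trims. The value is
    the first argument of [F], and its uniqueness is asked among sets of M. *)
Lemma M_repl a (F : U -> U -> Prop) : M a -> df (fun e => F (e 0) (e 1)) ->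
  (forall x, x ∈ a -> exists! y, M y /\ F y x) ->
  exists b, M b /\ forall y, y ∈ b <-> M y /\ exists x, x ∈ a /\ F y x.
Proof.
  intros Ha Hdf HF. pose proof Hdf as [p [c [Hc Hp]]].
  set (r := on_parity (fun k => match k with S O => 1 | _ => 0 end) (fun k => S (S k))).
  assert (E : forall x y, M x -> M y -> (sat M (ren r p) (scons y (scons x c)) <-> F y x)).
  { intros x y Hx Hy.
    rewrite (Hp (fun i => match i with O => y | S O => x | _ => y end))
      by (intros [|[|i]]; auto).
    apply sat_ren. intros i. unfold r.
    destruct (parity_cases i) as [k [->| ->]].
    - rewrite join_even, on_parity_even. destruct k as [|[|k]]; reflexivity.
    - now rewrite join_odd, on_parity_odd. }
  destruct (@ZFC_replacement _ M (proj2 HM) (ren r p) c a Hc Ha) as [b [Hb H]].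
  - intros x Hx Hxa. destruct (HF x Hxa) as [y [[Hy HFy] Hu]].
    exists y. split.
    + split; auto. now apply E.
    + intros y' [Hy' Hs]. apply Hu. split; auto. now apply E in Hs.
  - exists (sep b (fun y => exists x, x ∈ a /\ F y x)). split.
    + apply M_sep; auto. apply df_bex with (phi := fun x e => F (e 0) x).
      * now apply dft_cst.
      * exact (df_ren (fun i => match i with O => 1 | _ => 0 end) Hdf).
    + intros y. rewrite mem_sep. split.
      * intros [H1 H2]. split; auto. exact (M_trans Hb H1).
      * intros [Hy [x [Hx HFx]]]. split; eauto.
        pose proof (M_trans Ha Hx) as Mx.
        destruct (H x Mx Hx) as [y' [My' [Hy' Hs]]].
        apply E in Hs; auto. destruct (HF x Hx) as [y0 [_ Hu]].
        rewrite <- (Hu y) by auto. rewrite (Hu y') by auto. auto.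
Qed.

End Definability.

(** * Sets and functions inside a model *)

Section Universe.
Context {U : universe}.
Implicit Types (x y z a b n : U).

Lemma mem_sing x z : z ∈ sing x <-> z = x.
Proof. unfold sing. rewrite mem_upair. tauto. Qed.

Lemma upair_inj x y x' y' : upair x y = upair x' y' ->
  (x = x' /\ y = y') \/ (x = y' /\ y = x').
Proof.
  intros H.
  assert (A : forall z, (z = x \/ z = y) <-> (z = x' \/ z = y'))
    by (intros z; now rewrite <- !mem_upair, H).
  pose proof (proj1 (A x) (or_introl eq_refl)).
  pose proof (proj1 (A y) (or_intror eq_refl)).
  pose proof (proj2 (A x') (or_introl eq_refl)).
  pose proof (proj2 (A y') (or_intror eq_refl)).
  intuition congruence.
Qed.

Lemma opair_inj x y x' y' : opair x y = opair x' y' -> x = x' /\ y = y'.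
Proof.
  unfold opair, sing. intros H.
  destruct (upair_inj H) as [[H1 H2]|[H1 H2]];
  apply upair_inj in H1; apply upair_inj in H2; intuition congruence.
Qed.

Definition ofst z : U := epsilon (inhabits z) (fun x => exists y, z = opair x y).
Definition osnd z : U := epsilon (inhabits z) (fun y => exists x, z = opair x y).

Lemma ofst_opair x y : ofst (opair x y) = x.
Proof.
  unfold ofst. pose proof (epsilon_spec (inhabits (opair x y))
    (fun a => exists b, opair x y = opair a b)) as H.
  destruct H as [b H]; [eauto|]. symmetry. exact (proj1 (opair_inj H)).
Qed.

Lemma osnd_opair x y : osnd (opair x y) = y.
Proof.
  unfold osnd. pose proof (epsilon_spec (inhabits (opair x y))
    (fun b => exists a, opair x y = opair a b)) as H.
  destruct H as [b H]; [eauto|]. symmetry. exact (proj2 (opair_inj H)).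
Qed.

Definition prod a b : U :=
  sep (pow (pow (bigcup (upair a b))))
      (fun z => exists x, x ∈ a /\ exists y, y ∈ b /\ z = opair x y).

Lemma mem_prod a b z : z ∈ prod a b <-> exists x, x ∈ a /\ exists y, y ∈ b /\ z = opair x y.
Proof.
  unfold prod. rewrite mem_sep. split; [tauto|]. intros H. split; auto.
  destruct H as [x [Hx [y [Hy ->]]]]. apply mem_pow. intros w Hw. apply mem_pow.
  intros v Hv. apply mem_bigcup. unfold opair, sing in Hw. apply mem_upair in Hw.
  destruct Hw as [->| ->]; apply mem_upair in Hv; destruct Hv as [->| ->];
    eexists; rewrite mem_upair; eauto.
Qed.

Lemma opair_prod a b x y : opair x y ∈ prod a b <-> x ∈ a /\ y ∈ b.
Proof.
  rewrite mem_prod. split.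
  - intros [x' [Hx [y' [Hy E]]]]. apply opair_inj in E. destruct E as [-> ->]. auto.
  - intros [Hx Hy]. eauto.
Qed.

Lemma mem_irrefl x : x ∉ x.
Proof. induction (mem_wf x) as [x _ IH]. intros H. exact (IH x H H). Qed.

Definition emp : U := sep infset (fun _ => False).

Lemma mem_emp z : z ∉ emp.
Proof. unfold emp. rewrite mem_sep. tauto. Qed.

Definition succ n : U := bigcup (upair n (sing n)).

Lemma mem_succ n z : z ∈ succ n <-> z ∈ n \/ z = n.
Proof.
  unfold succ. rewrite mem_bigcup. split.
  - intros [y [Hy Hz]]. apply mem_upair in Hy. destruct Hy as [->| ->]; auto.
    right. now apply mem_sing.
  - intros [H| ->]; [exists n|exists (sing n)]; rewrite mem_upair; auto.
    rewrite mem_sing. auto.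
Qed.

Fixpoint num (k : nat) : U := match k with O => emp | S j => succ (num j) end.

Lemma mem_num k z : z ∈ num k <-> exists j, j < k /\ z = num j.
Proof.
  induction k as [|k IH]; simpl.
  - split; [intros H; now apply mem_emp in H|]. intros [j [Hj _]]. lia.
  - rewrite mem_succ, IH. split.
    + intros [[j [Hj ->]]| ->]; [exists j|exists k]; auto.
    + intros [j [Hj ->]]. destruct (Nat.eq_dec j k) as [->|Hn]; auto.
      left. exists j. split; auto. lia.
Qed.

Lemma num_lt i j : num i ∈ num j <-> i < j.
Proof.
  split.
  - intros H. destruct (le_lt_dec j i) as [Hle|]; auto. exfalso.
    apply mem_num in H. destruct H as [k [Hk E]].
    apply (mem_irrefl (x := num i)). rewrite E at 1. apply mem_num. exists k. split; auto. lia.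
  - intros H. apply mem_num. eauto.
Qed.

Lemma num_inj i j : num i = num j -> i = j.
Proof.
  intros H. destruct (lt_eq_lt_dec i j) as [[Hl|]|Hl]; auto; exfalso;
  apply num_lt in Hl; rewrite H in Hl; now apply mem_irrefl in Hl.
Qed.

(** A description of the natural numbers by bounded quantifiers, from which M can separate [omega];
    well-foundedness of membership excludes everything else. *)
Definition nat_like n := forall m, m ∈ succ n ->
  (forall z, z ∈ m -> False) \/ (exists k, k ∈ m /\ m = succ k).

Lemma num_nat_like k : nat_like (num k).
Proof.
  intros m Hm. change (m ∈ num (S k)) in Hm. apply mem_num in Hm.
  destruct Hm as [[|j] [_ ->]].
  - left. exact mem_emp.
  - right. exists (num j). split; auto. apply num_lt. auto.
Qed.

Lemma nat_like_num n : nat_like n -> exists k, n = num k.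
Proof.
  induction (mem_wf n) as [n _ IH]. intros H.
  destruct (H n) as [H0|[m [Hm E]]].
  - apply mem_succ; auto.
  - exists 0. apply mem_ext. intros z. split; intros Hz; [now apply H0 in Hz|now apply mem_emp in Hz].
  - destruct (IH m Hm) as [k ->].
    + intros w Hw. apply H. rewrite E. apply mem_succ. left. now rewrite <- E, E.
    + exists (S k). auto.
Qed.

Lemma mem_omega n : n ∈ omega <-> exists k, n = num k.
Proof.
  unfold omega. rewrite mem_sep. split.
  - intros [_ H].
    assert (A : n ∈ sep infset (fun n => exists k, n = num k)); [|now apply mem_sep in A].
    apply H. split.
    + destruct (@infset0 U) as [e [He H0]]. exists e. split; auto. apply mem_sep. split; auto.
      exists 0. apply mem_ext. intros z. split; intros Hz; [now apply H0 in Hz|now apply mem_emp in Hz].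
    + intros y Hy. apply mem_sep in Hy. destruct Hy as [Hy [k ->]].
      destruct (@infsetS U _ Hy) as [s [Hs H1]]. exists s. split; auto.
      apply mem_sep. split; auto. exists (S k). apply mem_ext. intros z.
      rewrite H1. simpl. now rewrite mem_succ.
  - assert (A : forall a k, is_inductive a -> num k ∈ a).
    { intros a k [[e [He H0]] HS]. induction k as [|k IH].
      - simpl. replace emp with e; auto. apply mem_ext.
        intros z. split; intros Hz; [now apply H0 in Hz|now apply mem_emp in Hz].
      - destruct (HS _ IH) as [s [Hs H1]]. simpl. replace (succ (num k)) with s; auto.
        apply mem_ext. intros z. rewrite H1, mem_succ. tauto. }
    intros [k ->]. split; auto. apply A. split; [apply infset0|apply infsetS].
Qed.

Lemma num_omega k : num k ∈ omega.
Proof. apply mem_omega. eauto. Qed.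

End Universe.

Section Closure.
Context {U : universe} (M : U -> Prop) (HM : transitive_model M).
Implicit Types (x y z a b n : U).

Definition powM a : U := sep (pow a) M.

Lemma mem_powM a z : z ∈ powM a <-> M z /\ subset z a.
Proof. unfold powM. rewrite mem_sep, mem_pow. unfold subset. tauto. Qed.

Lemma M_upair x y : M x -> M y -> M (upair x y).
Proof.
  intros Hx Hy. destruct (ZFC_pairing (proj2 HM) Hx Hy) as [a [Ha [H1 H2]]].
  replace (upair x y) with (sep a (fun z => z = x \/ z = y)).
  - apply (M_sep HM); auto.
    apply df_or; apply (df_eq HM); first [apply (dft_var HM)|now apply dft_cst].
  - apply mem_ext. intros z. rewrite mem_sep, mem_upair. split; [tauto|].
    intros [->| ->]; auto.
Qed.

Lemma M_sing x : M x -> M (sing x).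
Proof. intros. now apply M_upair. Qed.

Lemma M_opair x y : M x -> M y -> M (opair x y).
Proof. intros. apply M_upair; [now apply M_sing|now apply M_upair]. Qed.

Lemma M_bigcup a : M a -> M (bigcup a).
Proof.
  intros Ha. destruct (ZFC_union (proj2 HM) Ha) as [b [Hb H]].
  replace (bigcup a) with (sep b (fun z => exists y, y ∈ a /\ z ∈ y)).
  - apply (M_sep HM); auto. apply (df_bex HM) with (phi := fun y e => e 0 ∈ y).
    + now apply dft_cst.
    + apply (df_var_mem HM 1 0).
  - apply mem_ext. intros z. rewrite mem_sep, mem_bigcup. split; [tauto|].
    intros H1. split; auto. destruct H1 as [y [Hy Hz]].
    pose proof (M_trans HM Ha Hy) as My. pose proof (M_trans HM My Hz). eauto.
Qed.

Lemma M_succ n : M n -> M (succ n).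
Proof. intros. apply M_bigcup, M_upair; auto. now apply M_sing. Qed.

Lemma M_powM a : M a -> M (powM a).
Proof.
  intros Ha. destruct (ZFC_power (proj2 HM) Ha) as [b [Hb H]].
  replace (powM a) with (sep b (fun z => forall w, w ∈ z -> w ∈ a)).
  - apply (M_sep HM); auto. apply (df_ball HM) with (s := fun e => e 0) (phi := fun w e => w ∈ a).
    + apply (dft_var HM).
    + apply (df_mem HM); [apply (dft_var HM)|now apply dft_cst].
  - apply mem_ext. intros z. rewrite mem_sep, mem_powM. split.
    + intros [H1 H2]. split; auto. exact (M_trans HM Hb H1).
    + intros [H1 H2]. split; auto.
Qed.

Lemma dft_upair s t : dft M s -> dft M t -> dft M (fun e => upair (s e) (t e)).
Proof.
  intros Hs Ht. apply (dft_ext HM).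
  - intros e He. apply M_upair; [apply Hs|apply Ht]; auto.
  - apply df_ext with (fun e => e 0 = s (fun i => e (S i)) \/ e 0 = t (fun i => e (S i))).
    + intros e He. rewrite mem_upair. tauto.
    + apply df_or; apply (df_eq HM); first [now apply dft_shift|apply (dft_var HM)].
Qed.

Lemma dft_sing s : dft M s -> dft M (fun e => sing (s e)).
Proof. intros. now apply dft_upair. Qed.

Lemma dft_opair s t : dft M s -> dft M t -> dft M (fun e => opair (s e) (t e)).
Proof. intros. apply dft_upair; now apply dft_upair. Qed.

Lemma dft_bigcup s : dft M s -> dft M (fun e => bigcup (s e)).
Proof.
  intros Hs. apply (dft_ext HM).
  - intros e He. apply M_bigcup, Hs; auto.
  - apply df_ext with (fun e => exists y, y ∈ s (fun i => e (S i)) /\ e 0 ∈ y).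
    + intros e He. now rewrite mem_bigcup.
    + apply (df_bex HM) with (phi := fun y e => e 0 ∈ y);
      [now apply dft_shift|apply (df_var_mem HM 1 0)].
Qed.

Lemma dft_succ s : dft M s -> dft M (fun e => succ (s e)).
Proof. intros. apply dft_bigcup, dft_upair; auto. now apply dft_sing. Qed.

End Closure.

Ltac in_M_ext := fail.
Ltac in_M :=
  match goal with
  | H : ?M ?x |- ?M ?x => exact H
  | HM : transitive_model ?M |- ?M _ =>
    first [ apply (M_opair HM) | apply (M_sing HM) | apply (M_upair HM) | apply (M_succ HM)
          | apply (M_bigcup HM) | apply (M_powM HM) | in_M_ext ]; in_M
  end.

Ltac dft_step :=
  match goal with HM : transitive_model ?M |- dft ?M _ =>
    first [ apply (dft_var HM) | apply dft_cst; solve [in_M]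
          | apply (dft_opair HM) | apply (dft_sing HM) | apply (dft_upair HM)
          | apply (dft_succ HM) | apply (dft_bigcup HM) ]
  end.

Ltac df_step :=
  match goal with HM : transitive_model ?M |- df ?M _ =>
    first [ apply (df_cst HM) | apply df_iff | apply df_and | apply df_or
          | apply df_not | apply df_all | apply (df_ball HM)
          | apply df_ex | apply (df_bex HM) | apply df_imp
          | apply (df_mem HM) | apply (df_eq HM)
          | match goal with H : df M _ |- _ =>
              first [apply (df_app1 H) | apply (df_app2 H) | apply (df_app3 H)] end ]; cbv beta
  end.

Ltac dfs := repeat first [ assumption | df_step | dft_step ].

(** * Products, [omega], finite sets and choice functions in a model *)

Section Constructions.
Context {U : universe} (M : U -> Prop) (HM : transitive_model M).
Implicit Types (x y z a b n : U).

Lemma M_prod a b : M a -> M b -> M (prod a b).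
Proof.
  intros Ha Hb.
  replace (prod a b) with (sep (powM M (powM M (bigcup (upair a b))))
      (fun z => exists x, x ∈ a /\ exists y, y ∈ b /\ z = opair x y)).
  - apply (M_sep HM); [in_M|]. dfs.
  - apply mem_ext. intros z. rewrite mem_sep, mem_prod. split; [tauto|].
    intros H. split; auto. destruct H as [x [Hx [y [Hy ->]]]].
    pose proof (M_trans HM Ha Hx) as Mx. pose proof (M_trans HM Hb Hy) as My.
    apply mem_powM. split; [in_M|]. intros w Hw. apply mem_powM.
    assert (Hw' : w = upair x x \/ w = upair x y) by (now apply mem_upair in Hw).
    split; [destruct Hw' as [->| ->]; in_M|].
    intros v Hv. apply mem_bigcup.
    destruct Hw' as [->| ->]; apply mem_upair in Hv; destruct Hv as [->| ->];
    eexists; rewrite mem_upair; eauto.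
Qed.

Lemma M_omega : M omega.
Proof.
  destruct (ZFC_infinity (proj2 HM)) as [a [Ha [[o [Mo [Ho H0]]] HS]]].
  replace omega with (sep a (@nat_like U)).
  - apply (M_sep HM); auto. unfold nat_like. dfs.
  - apply mem_ext. intros z. rewrite mem_sep, mem_omega. split.
    + intros [_ H]. now apply nat_like_num.
    + intros [k ->]. split; [|apply num_nat_like].
      induction k as [|k IH].
      * simpl. replace emp with o; auto. apply mem_ext. intros z.
        split; intros Hz; [|now apply mem_emp in Hz].
        exfalso. exact (H0 z (M_trans HM Mo Hz) Hz).
      * destruct (HS (num k)) as [s [Ms [Hs H1]]]; auto.
        { exact (M_trans HM Ha IH). }
        simpl. replace (succ (num k)) with s; auto. apply mem_ext. intros z.
        rewrite mem_succ. split; intros Hz.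
        -- apply H1; auto. exact (M_trans HM Ms Hz).
        -- apply H1; auto. destruct Hz as [Hz| ->]; [|exact (M_trans HM Ha IH)].
           exact (M_trans HM (M_trans HM Ha IH) Hz).
Qed.

Lemma M_num k : M (num k).
Proof. exact (M_trans HM M_omega (num_omega k)). Qed.

(** The selecting predicate [k] need not be known to M: a finite set is built from its elements one
    at a time. Applied to membership in rho_G, this puts each finite trace of rho_G into the ground
    model. *)
Lemma M_list (l : list U) (k : U -> Prop) : (forall h, In h l -> M h) ->
  exists K, M K /\ forall h, h ∈ K <-> In h l /\ k h.
Proof.
  induction l as [|a l IH]; intros Hl.
  - exists (num 0). split; [apply M_num|]. intros h. simpl.
    split; [intros H; now apply mem_emp in H|tauto].
  - destruct IH as [K [MK HK]]; [intros; apply Hl; simpl; auto|].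
    destruct (classic (k a)) as [Ha|Ha].
    + exists (bigcup (upair K (sing a))). split.
      * assert (M a) by (apply Hl; simpl; auto). in_M.
      * intros h. rewrite mem_bigcup. simpl. split.
        -- intros [y [Hy Hh]]. apply mem_upair in Hy. destruct Hy as [->| ->].
           ++ apply HK in Hh. tauto.
           ++ apply mem_sing in Hh. subst. auto.
        -- intros [[<-|Hh] Hk].
           ++ exists (sing a). rewrite mem_upair, mem_sing. auto.
           ++ exists K. rewrite mem_upair, HK. auto.
    + exists K. split; auto. intros h. rewrite HK. simpl. split; [tauto|].
      intros [[<-|Hh] Hk]; tauto.
Qed.

Lemma df_In t (l : list U) : dft M t -> (forall h, In h l -> M h) -> df M (fun e => In (t e) l).
Proof.
  intros Ht. induction l as [|a l IH]; intros Hl; simpl.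
  - apply (df_cst HM).
  - apply df_or; [|apply IH; simpl in Hl; auto].
    assert (M a) by (apply Hl; simpl; auto). dfs.
Qed.

Lemma df_list_all (l : list U) (phi : U -> (nat -> U) -> Prop) :
  (forall h, In h l -> df M (phi h)) -> df M (fun e => forall h, In h l -> phi h e).
Proof.
  induction l as [|a l IH]; intros Hl; simpl.
  - apply df_ext with (fun _ => True); [|apply (df_cst HM)]. tauto.
  - apply df_ext with (fun e => phi a e /\ forall h, In h l -> phi h e).
    + intros e He. split.
      * intros [H1 H2] h [<-|Hh]; auto.
      * intros H. split; auto.
    + apply df_and; [apply Hl; simpl; auto|]. apply IH. intros. apply Hl. simpl; auto.
Qed.

(** The axiom of choice speaks of disjoint families. Replacing the candidates [y] for [x] by the
    pairs [opair x y] makes the fibres over different [x] disjoint. *)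
Lemma M_choice X Y (Rel : U -> U -> Prop) : M X -> M Y ->
  df M (fun e => Rel (e 0) (e 1)) ->
  exists c, M c /\ (forall x y, opair x y ∈ c -> x ∈ X /\ y ∈ Y /\ Rel x y) /\
    (forall x y y', opair x y ∈ c -> opair x y' ∈ c -> y = y') /\
    (forall x, x ∈ X -> (exists y, y ∈ Y /\ Rel x y) -> exists y, opair x y ∈ c).
Proof.
  intros HX HY HR.
  pose (fib := fun x w => forall z, M z -> (z ∈ w <-> exists y, y ∈ Y /\ Rel x y /\ z = opair x y)).
  pose (a := sep (powM M (prod X Y))
    (fun w => exists x, x ∈ X /\ (exists y, y ∈ Y /\ Rel x y) /\ fib x w)).
  assert (MXY : M (prod X Y)) by now apply M_prod.
  assert (Ma : M a).
  { apply (M_sep HM); [in_M|]. unfold fib. 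
    dfs. }
  destruct (ZFC_choice (proj2 HM) Ma) as [c0 [Mc0 Hc0]].
  - intros w Mw Hw. apply mem_sep in Hw. destruct Hw as [_ [x [Hx [[y [Hy Hr]] Hf]]]].
    exists (opair x y). pose proof (M_trans HM HX Hx). pose proof (M_trans HM HY Hy) as My.
    split; [in_M|]. apply Hf; [in_M|]. eauto.
  - intros w w' z Mw Mw' Mz Hw Hw' Hz Hz'. apply mem_sep in Hw, Hw'.
    destruct Hw as [_ [x [Hx [_ Hf]]]]. destruct Hw' as [_ [x' [Hx' [_ Hf']]]].
    apply (ZFC_extensionality (proj2 HM)); auto.
    pose proof (proj1 (Hf z Mz) Hz) as [y [_ [_ E]]].
    pose proof (proj1 (Hf' z Mz) Hz') as [y' [_ [_ E']]].
    rewrite E in E'. apply opair_inj in E'. destruct E' as [<- _].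
    intros v Mv. rewrite (Hf v Mv), (Hf' v Mv). tauto.
  - assert (Key : forall x, x ∈ X -> (exists y, y ∈ Y /\ Rel x y) ->
      exists! z, M z /\ (exists y, y ∈ Y /\ Rel x y /\ z = opair x y) /\ z ∈ c0).
    { intros x Hx Hy. assert (M x) by exact (M_trans HM HX Hx).
      pose (w := sep (prod X Y) (fun z => exists y, y ∈ Y /\ Rel x y /\ z = opair x y)).
      assert (Mw : M w).
      { apply (M_sep HM); auto. dfs. }
      assert (Hw : forall z, z ∈ w <-> exists y, y ∈ Y /\ Rel x y /\ z = opair x y).
      { intros z. unfold w. rewrite mem_sep. split; [tauto|]. intros Hz. split; auto.
        destruct Hz as [y [Hy' [_ ->]]]. now apply opair_prod. }
      destruct (Hc0 w Mw) as [z [[Mz [Hz Hzc]] Hu]].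
      - apply mem_sep. split.
        + apply mem_powM. split; auto. intros z Hz. now apply mem_sep in Hz.
        + exists x. split; auto. split; auto. intros z Mz. apply Hw.
      - exists z. split; [split; auto; split; auto; now apply Hw|].
        intros z' [Mz' [Hz' Hzc']]. apply Hu. split; auto. split; auto. now apply Hw. }
    (* A choice set may have members outside all fibres; these are removed. *)
    exists (sep (prod X Y) (fun z => z ∈ c0 /\ exists x, x ∈ X /\ exists y, y ∈ Y /\ Rel x y /\ z = opair x y)).
    split; [|split; [|split]].
    + apply (M_sep HM); auto. dfs.
    + intros x y H. apply mem_sep in H. destruct H as [_ [_ [x' [Hx [y' [Hy [Hr E]]]]]]].
      apply opair_inj in E. destruct E as [-> ->]. auto.
    + intros x y y' H H'. apply mem_sep in H, H'.
      destruct H as [_ [Hc [x1 [Hx [y1 [Hy [Hr E]]]]]]].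
      destruct H' as [_ [Hc' [x2 [Hx2 [y2 [Hy2 [Hr2 E2]]]]]]].
      apply opair_inj in E, E2. destruct E as [<- <-]. destruct E2 as [<- <-].
      destruct (Key x Hx) as [z [_ Hu]]; [eauto|].
      pose proof (M_trans HM Mc0 Hc). pose proof (M_trans HM Mc0 Hc').
      apply (opair_inj (x := x) (x' := x)).
      rewrite <- (Hu (opair x y)), <- (Hu (opair x y')); eauto 10.
    + intros x Hx Hy. destruct (Key x Hx Hy) as [z [[Mz [[y [Hy' [Hr ->]]] Hzc]] _]].
      exists y. apply mem_sep. split; [now apply opair_prod|]. eauto 10.
Qed.

End Constructions.

Ltac in_M_ext ::=
  match goal with HM : transitive_model ?M |- ?M _ =>
    first [ apply (M_prod HM) | apply (M_omega HM) | apply (M_num HM) ]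
  end.

(** * Dependent choice and transitive closure inside a model *)

Section DependentChoice.
Context {U : universe} (M : U -> Prop) (HM : transitive_model M).
Implicit Types (x y z a b s t : U).

(* Inv need not be definable over M; it only restricts where Q must be total. *)
Lemma M_dependent_choice S (Q : U -> U -> U -> Prop) (Inv : U -> Prop) s0 :
  M S -> df M (fun e => Q (e 0) (e 1) (e 2)) -> s0 ∈ S -> Inv s0 ->
  (forall n s, s ∈ S -> Inv s -> exists t, t ∈ S /\ Q (num n) s t) ->
  (forall n s t, s ∈ S -> t ∈ S -> Inv s -> Q (num n) s t -> Inv t) ->
  exists g : nat -> U, g 0 = s0 /\
    (forall n, g n ∈ S /\ Inv (g n) /\ Q (num n) (g n) (g (Datatypes.S n))) /\
    exists F, M F /\ forall s, s ∈ F <-> exists n, s = g n.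
Proof.
  intros MS HQ Hs0 Hi0 Htot Hinv.
  destruct (@M_choice U M HM (prod omega S) S
    (fun x t => exists n, n ∈ omega /\ exists s, s ∈ S /\ x = opair n s /\ Q n s t))
    as [c [Mc [Hc1 [Hc2 Hc3]]]].
  - in_M.
  - in_M.
  - dfs.
  (* The recursion runs in the ambient universe, but each of its choices is made by the set [c] of
     M, so that M can retrace it. *)
  - pose (g := fix g n := match n with O => s0 | Datatypes.S k =>
      epsilon (inhabits s0) (fun t => opair (opair (num k) (g k)) t ∈ c) end).
    assert (Hstep : forall n, g n ∈ S -> Inv (g n) ->
      opair (opair (num n) (g n)) (g (Datatypes.S n)) ∈ c).
    { intros n H1 H2. simpl.
      apply (epsilon_spec (inhabits s0) (fun t => opair (opair (num n) (g n)) t ∈ c)).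
      apply Hc3.
      - apply opair_prod. split; [apply num_omega|auto].
      - destruct (Htot n (g n) H1 H2) as [t [Ht HQt]].
        exists t. split; auto. exists (num n). split; [apply num_omega|]. exists (g n). auto. }
    assert (Hst : forall n, g n ∈ S -> Inv (g n) ->
       g (Datatypes.S n) ∈ S /\ Q (num n) (g n) (g (Datatypes.S n))).
    { intros n H1 H2. destruct (Hc1 _ _ (Hstep n H1 H2)) as [_ [H3 [m [_ [s [_ [E H4]]]]]]].
      apply opair_inj in E. destruct E as [<- <-]. auto. }
    assert (Hg : forall n, g n ∈ S /\ Inv (g n)).
    { induction n as [|n [H1 H2]]; [split; auto|].
      destruct (Hst n H1 H2) as [H3 H4]. split; auto. exact (Hinv n _ _ H1 H3 H2 H4). }
    exists g. split; [reflexivity|]. split.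
    { intros n. destruct (Hg n) as [H1 H2]. split; auto. split; auto. now apply Hst. }
    (* Each pair of an approximation is the initial one or arises by [c] from another pair of the
       same approximation. By induction on the index it contains only pairs of [num n] and [g n], so
       M can define the range of [g] through its own approximations. *)
    pose (approx := fun h => forall p, p ∈ h ->
      p = opair (num 0) s0 \/ exists m, m ∈ omega /\ exists s, s ∈ S /\ opair m s ∈ h /\
        exists t, t ∈ S /\ p = opair (succ m) t /\ opair (opair m s) t ∈ c).
    assert (Ms0 : M s0) by exact (M_trans HM MS Hs0).
    exists (sep S (fun s => exists m, m ∈ omega /\ exists h, M h /\ (approx h /\ opair m s ∈ h))).
    split; [apply (M_sep HM); auto; unfold approx; dfs|].
    assert (Ha : forall n h s, approx h -> opair (num n) s ∈ h -> s = g n).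
    { induction n as [|n IH]; intros h s Hh Hs.
      - destruct (Hh _ Hs) as [E|[m [_ [s' [_ [_ [t [_ [E _]]]]]]]]]; apply opair_inj in E; destruct E as [E1 E2]; auto.
        exfalso. apply (mem_emp (z := m)). change emp with (@num U 0). rewrite E1. apply mem_succ. auto.
      - destruct (Hh _ Hs) as [E|[m [Hm [s' [Hs' [H2 [t [_ [E H3]]]]]]]]]; apply opair_inj in E; destruct E as [E1 ->].
        + exfalso. apply (num_inj (i := Datatypes.S n) (j := 0)) in E1. lia.
        + apply mem_omega in Hm. destruct Hm as [k ->].
          change (@num U (Datatypes.S n) = num (Datatypes.S k)) in E1. apply num_inj in E1.
          injection E1 as <-. rewrite (IH h s' Hh H2) in H3.
          destruct (Hg n) as [G1 G2]. exact (Hc2 _ _ _ H3 (Hstep n G1 G2)). }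
    intros s. rewrite mem_sep. split.
    + intros [Hs [m [Hm [h [Mh [Hh H]]]]]]. apply mem_omega in Hm. destruct Hm as [n ->].
      exists n. eapply Ha; eauto.
    + intros [n ->]. split; [apply Hg|]. exists (num n). split; [apply num_omega|].
      assert (Hex : exists h, M h /\ approx h /\ opair (num n) (g n) ∈ h).
      { induction n as [|n [h [Mh [Hh H]]]].
        - exists (sing (opair (num 0) s0)). split; [in_M|]. split; [|now apply mem_sing].
          intros p Hp. left. now apply mem_sing.
        - exists (bigcup (upair h (sing (opair (num (Datatypes.S n)) (g (Datatypes.S n)))))).
          assert (M (g (Datatypes.S n))) by exact (M_trans HM MS (proj1 (Hg _))).
          assert (Hin : forall p, p ∈ bigcup (upair h (sing (opair (num (Datatypes.S n)) (g (Datatypes.S n)))))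
             <-> p ∈ h \/ p = opair (num (Datatypes.S n)) (g (Datatypes.S n))).
          { intros p. rewrite mem_bigcup. split.
            - intros [y [Hy Hp]]. apply mem_upair in Hy. destruct Hy as [->| ->]; auto.
              right. now apply mem_sing.
            - intros [Hp|Hp]; [exists h|eexists (sing _)]; rewrite mem_upair; split; auto.
              now apply mem_sing. }
          split; [in_M|]. split; [|apply Hin; auto].
          intros p Hp. apply Hin in Hp. destruct Hp as [Hp| ->].
          + destruct (Hh p Hp) as [?|[m [Hm [s [Hs [H1 H2]]]]]]; auto.
            right. exists m. split; auto. exists s. split; auto. split; auto. apply Hin; auto.
          + right. exists (num n). split; [apply num_omega|]. exists (g n).
            split; [apply Hg|]. split; [apply Hin; auto|]. exists (g (Datatypes.S n)).
            split; [apply Hg|]. split; auto. apply Hstep; apply Hg. }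
      exact Hex.
Qed.

Definition theta_ok (X : U) (theta : U -> U -> Prop) (l : list U) : Prop :=
  (forall z, In z l -> z ∈ X) /\ forall z z', In z l -> In z' l -> theta z z'.

(** The common core of all back-and-forth arguments: [theta] expresses coherence of two pieces, and
    [psi1], [psi2] are two sequences of tasks. Only finite coherent sets have to be extendable;
    tasks without any candidate in [X] are skipped. *)
Lemma M_generic_clique X (theta psi1 psi2 : U -> U -> Prop) :
  M X -> df M (fun e => theta (e 0) (e 1)) ->
  df M (fun e => psi1 (e 0) (e 1)) -> df M (fun e => psi2 (e 0) (e 1)) ->
  (forall l n, theta_ok X theta l -> (exists z, z ∈ X /\ psi1 (num n) z) ->
     exists z, psi1 (num n) z /\ theta_ok X theta (z :: l)) ->
  (forall l n, theta_ok X theta l -> (exists z, z ∈ X /\ psi2 (num n) z) ->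
     exists z, psi2 (num n) z /\ theta_ok X theta (z :: l)) ->
  exists g, M g /\ subset g X /\ (forall z z', z ∈ g -> z' ∈ g -> theta z z') /\
    forall n, ((exists z, z ∈ X /\ psi1 (num n) z) -> exists z, z ∈ g /\ psi1 (num n) z) /\
              ((exists z, z ∈ X /\ psi2 (num n) z) -> exists z, z ∈ g /\ psi2 (num n) z).
Proof.
  intros MX Hth Hp1 Hp2 H1 H2.
  (* Finiteness enters [Q] only as the definable bound that at most two elements are added per step.
     The list witnessing finiteness is kept in [Inv] and propagated by this bound. *)
  pose (Q := fun n p q => (forall z, z ∈ p -> z ∈ q) /\
    (forall z, z ∈ q -> forall z', z' ∈ q -> theta z z') /\
    (exists z1, M z1 /\ exists z2, M z2 /\ forall z, z ∈ q -> z ∈ p \/ z = z1 \/ z = z2) /\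
    ((exists z, z ∈ X /\ psi1 n z) -> exists z, z ∈ q /\ psi1 n z) /\
    ((exists z, z ∈ X /\ psi2 n z) -> exists z, z ∈ q /\ psi2 n z)).
  pose (Inv := fun p => (forall z z', z ∈ p -> z' ∈ p -> theta z z') /\
    exists l, forall z, z ∈ p <-> In z l).
  assert (Hpow : forall l, (forall z, In z l -> z ∈ X) -> exists q, q ∈ powM M X /\ forall z, z ∈ q <-> In z l).
  { intros l Hl. destruct (M_list HM (l := l) (fun _ => True)) as [q [Mq Hq]].
    - intros h Hh. exact (M_trans HM MX (Hl h Hh)).
    - exists q. assert (E : forall z, z ∈ q <-> In z l) by (intros z; rewrite Hq; tauto).
      split; auto. apply mem_powM. split; auto. intros z Hz. apply Hl, E, Hz. }
  destruct (@M_dependent_choice (powM M X) Q Inv emp) as [g [Hg0 [Hg [F [MF HF]]]]].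
  - in_M.
  - unfold Q. dfs.
  - apply mem_powM. split; [exact (M_num HM 0)|]. intros z Hz. now apply mem_emp in Hz.
  - split; [intros z z' Hz; now apply mem_emp in Hz|]. exists nil.
    intros z. simpl. split; [apply mem_emp|tauto].
  - intros n s Hs [Hi [l Hl]]. apply mem_powM in Hs. destruct Hs as [Ms HsX].
    assert (Hok : theta_ok X theta l).
    { split; [intros z Hz; apply HsX, Hl, Hz|]. intros z z' Hz Hz'. apply Hi; apply Hl; auto. }
    assert (Step1 : exists l1 d1, theta_ok X theta l1 /\ (forall z, In z l -> In z l1) /\
       M d1 /\ (forall z, In z l1 -> In z l \/ z = d1) /\
       ((exists z, z ∈ X /\ psi1 (num n) z) -> exists z, In z l1 /\ psi1 (num n) z)).
    { destruct (classic (exists z, z ∈ X /\ psi1 (num n) z)) as [Hz|Hz].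
      - destruct (H1 l n Hok Hz) as [z [Hpz Hzl]]. exists (z :: l), z. split; auto. simpl.
        split; auto. split; [apply (M_trans HM MX), Hzl; simpl; auto|].
        split; [intros ? [->|?]; auto|]. eauto.
      - exists l, (num 0). split; auto. split; auto. split; [in_M|]. split; [auto|tauto]. }
    destruct Step1 as [l1 [d1 [Hok1 [Hll1 [Md1 [Hd1 Hz1]]]]]].
    assert (Step2 : exists l2 d2, theta_ok X theta l2 /\ (forall z, In z l1 -> In z l2) /\
       M d2 /\ (forall z, In z l2 -> In z l1 \/ z = d2) /\
       ((exists z, z ∈ X /\ psi2 (num n) z) -> exists z, In z l2 /\ psi2 (num n) z)).
    { destruct (classic (exists z, z ∈ X /\ psi2 (num n) z)) as [Hz|Hz].
      - destruct (H2 l1 n Hok1 Hz) as [z [Hpz Hzl]]. exists (z :: l1), z. split; auto. simpl.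
        split; auto. split; [apply (M_trans HM MX), Hzl; simpl; auto|].
        split; [intros ? [->|?]; auto|]. eauto.
      - exists l1, (num 0). split; auto. split; auto. split; [in_M|]. split; [auto|tauto]. }
    destruct Step2 as [l2 [d2 [Hok2 [Hll2 [Md2 [Hd2 Hz2]]]]]].
    destruct (Hpow l2 (proj1 Hok2)) as [q [Hq Hql]].
    exists q. split; auto. split; [|split; [|split; [|split]]].
    + intros z Hz. apply Hql, Hll2, Hll1, Hl, Hz.
    + intros z Hz z' Hz'. apply (proj2 Hok2); now apply Hql.
    + exists d1. split; auto. exists d2. split; auto. intros z Hz. apply Hql in Hz.
      destruct (Hd2 z Hz) as [Hz'|]; auto. destruct (Hd1 z Hz') as [Hz''|]; auto.
      left. now apply Hl.
    + intros Hz. destruct (Hz1 Hz) as [z [A B]]. exists z. split; auto. apply Hql; auto.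
    + intros Hz. destruct (Hz2 Hz) as [z [A B]]. exists z. split; auto. apply Hql; auto.
  - intros n s t Hs Ht [Hi [l Hl]] [Hst [Hth' [[z1 [_ [z2 [_ Hz]]]] _]]].
    split; [intros z z' Hz1 Hz2; now apply Hth'|].
    assert (Hsub : forall l', exists l'', forall z, In z l'' <-> z ∈ t /\ In z l').
    { induction l' as [|a l' [l'' IH]].
      - exists nil. simpl. tauto.
      - destruct (classic (a ∈ t)).
        + exists (a :: l''). intros z. simpl. rewrite IH. intuition congruence.
        + exists l''. intros z. simpl. rewrite IH. intuition congruence. }
    destruct (Hsub (z1 :: z2 :: l)) as [l'' Hl'']. exists l''.
    intros z. rewrite Hl''. split; [|tauto]. intros Hzt. split; auto. simpl.
    destruct (Hz z Hzt) as [A|[A|A]]; auto. right; right. now apply Hl.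
  - assert (Hmono : forall n m z, n <= m -> z ∈ g n -> z ∈ g m).
    { intros n m z Hnm Hz. induction Hnm; auto. now apply (proj1 (proj2 (proj2 (Hg m)))). }
    assert (HU : forall z, z ∈ bigcup F <-> exists n, z ∈ g n).
    { intros z. rewrite mem_bigcup. split.
      - intros [y [Hy Hz]]. apply HF in Hy. destruct Hy as [n ->]. eauto.
      - intros [n Hz]. exists (g n). split; auto. apply HF. eauto. }
    exists (bigcup F). split; [in_M|]. split; [|split].
    + intros z Hz. apply HU in Hz. destruct Hz as [n Hz].
      destruct (Hg n) as [Hn _]. apply mem_powM in Hn. now apply Hn.
    + intros z z' Hz Hz'. apply HU in Hz, Hz'. destruct Hz as [n Hz], Hz' as [m Hz'].
      destruct (Hg (max n m)) as [_ [[Hi _] _]]. apply Hi; (eapply Hmono; [|eassumption]); lia.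
    + intros n. destruct (Hg n) as [_ [_ [_ [_ [_ [A B]]]]]].
      split; intros Hz; [destruct (A Hz) as [z Hz']|destruct (B Hz) as [z Hz']];
      exists z; (split; [apply HU; exists (Datatypes.S n)|]; tauto).
Qed.

End DependentChoice.

Section TransitiveClosure.
Context {U : universe} (M : U -> Prop) (HM : transitive_model M).
Implicit Types (x y z a b n s t T : U).

Definition transitive_set T := forall y, y ∈ T -> forall z, z ∈ y -> z ∈ T.

Definition is_closure t T := transitive_set T /\ (forall z, z ∈ t -> z ∈ T) /\
  forall T', M T' -> transitive_set T' /\ (forall z, z ∈ t -> z ∈ T') -> forall z, z ∈ T -> z ∈ T'.

(** By induction along membership, Replacement collects the closures of the elements, which are
    unique because leastness among the sets of M is part of [is_closure]. Their union together with
    [t] is a transitive superset, and the intersection of all such sets of M is the closure. *)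
Lemma M_transitive_closure t : M t -> exists T, M T /\ is_closure t T.
Proof.
  induction (mem_wf t) as [t _ IH]. intros Mt.
  destruct (@M_repl U M HM t (fun T y => is_closure y T)) as [b [Mb Hb]]; auto.
  - unfold is_closure, transitive_set. dfs.
  - intros y Hy. destruct (IH y Hy (M_trans HM Mt Hy)) as [T [MT HT]].
    exists T. split; auto. intros T' [MT' HT']. apply mem_ext. intros z.
    destruct HT as [A [B C]], HT' as [A' [B' C']]. split; [apply C|apply C']; auto.
  - assert (Hex : exists T, M T /\ transitive_set T /\ forall z, z ∈ t -> z ∈ T).
    { exists (bigcup (upair t (bigcup b))). split; [in_M|].
      assert (HU : forall z, z ∈ bigcup (upair t (bigcup b)) <-> z ∈ t \/ exists T, T ∈ b /\ z ∈ T).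
      { intros z. rewrite mem_bigcup. split.
        - intros [y [Hy Hz]]. apply mem_upair in Hy. destruct Hy as [->| ->]; auto.
          right. now apply mem_bigcup.
        - intros [Hz|Hz]; [exists t|exists (bigcup b)]; rewrite mem_upair; auto.
          split; auto. now apply mem_bigcup. }
      split.
      - intros y Hy z Hz. apply HU in Hy. apply HU. right. destruct Hy as [Hy|[T [HT Hy]]].
        + destruct (IH y Hy (M_trans HM Mt Hy)) as [T [MT HT]]. exists T.
          split; [apply Hb; split; eauto|]. exact (proj1 (proj2 HT) z Hz).
        + exists T. split; auto. apply Hb in HT. destruct HT as [_ [x [_ [HT _]]]]. exact (HT y Hy z Hz).
      - intros z Hz. apply HU. auto. }
    destruct Hex as [T0 [MT0 [HT1 HT2]]].
    exists (sep T0 (fun z => forall T, M T -> transitive_set T /\ (forall z, z ∈ t -> z ∈ T) -> z ∈ T)).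
    split; [apply (M_sep HM); auto; unfold transitive_set; dfs|]. split; [|split].
    + intros y Hy z Hz. apply mem_sep in Hy. destruct Hy as [Hy1 Hy2]. apply mem_sep.
      split; [exact (HT1 y Hy1 z Hz)|]. intros T MT [A B]. exact (A y (Hy2 T MT (conj A B)) z Hz).
    + intros z Hz. apply mem_sep. split; auto. intros T _ [_ B]. auto.
    + intros T MT HT z Hz. apply mem_sep in Hz. now apply Hz.
Qed.

End TransitiveClosure.

(** * Copies of the Rado graph *)

Lemma list_is_finite (U : universe) (l : list U) :
  exists H, (forall z, z ∈ H <-> In z l) /\ is_finite H.
Proof.
  assert (A : exists H, (forall z, z ∈ H <-> In z l) /\ exists k f, is_bijection f (num k) H).
  { induction l as [|a l [H [HH [k [f [[[Hf1 Hf2] Hf3] Hf4]]]]]].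
    - exists emp. split; [intros z; simpl; split; [apply mem_emp|tauto]|].
      exists 0, emp. repeat split.
      + intros z Hz. now apply mem_emp in Hz.
      + intros x Hx. now apply mem_emp in Hx.
      + intros x x' y Hx. now apply mem_emp in Hx.
      + intros y Hy. now apply mem_emp in Hy.
    - destruct (classic (In a l)) as [Ha|Ha].
      + exists H. split; [|exists k, f; repeat split; auto].
        intros z. rewrite HH. simpl. split; auto. intros [<-|]; auto.
      + pose (H' := bigcup (upair H (sing a))).
        pose (f' := bigcup (upair f (sing (opair (num k) a)))).
        assert (EH : forall z, z ∈ H' <-> z ∈ H \/ z = a).
        { intros z. unfold H'. rewrite mem_bigcup. split.
          - intros [y [Hy Hz]]. apply mem_upair in Hy. destruct Hy as [->| ->]; auto.
            apply mem_sing in Hz. auto.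
          - intros [Hz|Hz]; [exists H|exists (sing a)]; rewrite mem_upair; auto.
            rewrite mem_sing. auto. }
        assert (Ef : forall z, z ∈ f' <-> z ∈ f \/ z = opair (num k) a).
        { intros z. unfold f'. rewrite mem_bigcup. split.
          - intros [y [Hy Hz]]. apply mem_upair in Hy. destruct Hy as [->| ->]; auto.
            apply mem_sing in Hz. auto.
          - intros [Hz|Hz]; [exists f|eexists (sing _)]; rewrite mem_upair; auto.
            rewrite mem_sing. auto. }
        assert (Hf1' : forall x y, opair x y ∈ f -> x ∈ num k /\ y ∈ H).
        { intros x y Hxy. destruct (Hf1 _ Hxy) as [x' [y' [Hx [Hy E]]]].
          apply opair_inj in E. destruct E as [-> ->]. auto. }
        assert (HaH : a ∉ H) by (now rewrite HH).
        exists H'. split.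
        { intros z. rewrite EH, HH. simpl. intuition congruence. }
        exists (S k), f'. repeat split.
        * intros z Hz. apply Ef in Hz. destruct Hz as [Hz| ->].
          -- destruct (Hf1 z Hz) as [x [y [Hx [Hy Ez]]]]. exists x, y.
             split; [simpl; apply mem_succ; auto|]. split; auto. apply EH; auto.
          -- exists (num k), a. split; [simpl; apply mem_succ; auto|]. split; auto.
             apply EH; auto.
        * intros x Hx. simpl in Hx. apply mem_succ in Hx. destruct Hx as [Hx| ->].
          -- destruct (Hf2 x Hx) as [y [Hy Hu]]. exists y. split; [apply Ef; auto|].
             intros y' Hy'. apply Ef in Hy'. destruct Hy' as [Hy'|Hy']; auto.
             apply opair_inj in Hy'. destruct Hy' as [-> _]. now apply mem_irrefl in Hx.
          -- exists a. split; [apply Ef; auto|]. intros y' Hy'. apply Ef in Hy'.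
             destruct Hy' as [Hy'|Hy'].
             ++ apply Hf1' in Hy'. destruct Hy' as [Hy' _]. now apply mem_irrefl in Hy'.
             ++ apply opair_inj in Hy'. symmetry. tauto.
        * intros x x' y Hx Hx'. apply Ef in Hx, Hx'. destruct Hx as [Hx|Hx], Hx' as [Hx'|Hx'].
          -- eapply Hf3; eauto.
          -- apply opair_inj in Hx'. destruct Hx' as [_ ->]. apply Hf1' in Hx. tauto.
          -- apply opair_inj in Hx. destruct Hx as [_ ->]. apply Hf1' in Hx'. tauto.
          -- apply opair_inj in Hx, Hx'. intuition congruence.
        * intros y Hy. apply EH in Hy. destruct Hy as [Hy| ->].
          -- destruct (Hf4 y Hy) as [x Hx]. exists x. apply Ef; auto.
          -- exists (num k). apply Ef; auto. }
  destruct A as [H [HH [k [f Hf]]]]. exists H. split; auto.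
  exists (num k), f. split; auto. apply num_omega.
Qed.

Section Rado.
Context {U : universe} (M : U -> Prop) (HM : transitive_model M).
Context (R E : U) (HR : is_rado M R E).
Implicit Types (A B C x y v f i tw : U) (k : U -> Prop).

Notation "x ~ y" := (opair x y ∈ E) (at level 70).
Notation PR := (copies M R E).

Lemma MR : M R. Proof. exact (rado_vertices HR). Qed.
Lemma ME : M E. Proof. exact (rado_edges HR). Qed.

Lemma adj_sym x y : x ~ y <-> y ~ x.
Proof. split; apply (graph_sym (rado_graph HR)). Qed.

Lemma adj_irrefl x : ~ x ~ x.
Proof. apply (graph_irrefl (rado_graph HR)). Qed.

(** The extension property with lists and arbitrary predicates in place of sets. It mentions no
    isomorphism, and for subsets of R in M it characterizes copies by [EP_copy] and [copy_of_EP], so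
    it is what constructions of copies verify. *)
Definition EP A := forall (l : list U) k, (forall h, In h l -> h ∈ A) ->
  exists v, v ∈ A /\ ~ In v l /\ forall h, In h l -> (v ~ h <-> k h).

Lemma EP_R : EP R.
Proof.
  intros l k Hl. destruct (list_is_finite l) as [H [HH Hf]].
  destruct (@rado_extension _ _ _ _ HR H (sep H k)) as [v Hv]; auto.
  - intros z Hz. apply Hl, HH, Hz.
  - intros z Hz. now apply mem_sep in Hz.
  - apply mem_sep in Hv. destruct Hv as [Hv [Hn [H1 H2]]]. exists v.
    split; auto. rewrite HH in Hn. split; auto. intros h Hh. split.
    + intros Hvh. apply NNPP. intros Hk. apply (H2 h); [now apply HH| |auto].
      rewrite mem_sep. tauto.
    + intros Hk. apply H1. apply mem_sep. rewrite HH. auto.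
Qed.

Lemma code_exists : exists c, M c /\
  (forall x, x ∈ R -> exists n, opair x (num n) ∈ c) /\
  (forall x x' n, opair x n ∈ c -> opair x' n ∈ c -> x = x') /\
  (forall x n n', opair x n ∈ c -> opair x n' ∈ c -> n = n').
Proof.
  destruct (rado_countable HR) as [c [Mc [[H1 H2] H3]]]. exists c. split; auto.
  split; [|split]; auto.
  - intros x Hx. destruct (H2 x Hx) as [y [Hy _]].
    destruct (H1 _ Hy) as [x' [y' [_ [Hy' Ez]]]]. apply opair_inj in Ez.
    destruct Ez as [_ ->]. apply mem_omega in Hy'. destruct Hy' as [n ->]. eauto.
  - intros x n n' Hn Hn'. destruct (H1 _ Hn) as [x' [y' [Hx [_ Ez]]]].
    apply opair_inj in Ez. destruct Ez as [-> _]. destruct (H2 x' Hx) as [y [_ Hu]].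
    rewrite <- (Hu n), <- (Hu n'); auto.
Qed.

(** A form of [is_iso_onto] with bounded quantifiers only. Pairs of [f] outside the product of [A]
    and [R] are ignored, so larger relations such as a labelling of several types can be used
    directly. *)
Definition biso f A :=
  (forall x, x ∈ A -> exists y, y ∈ R /\ opair x y ∈ f) /\
  (forall y, y ∈ R -> exists x, x ∈ A /\ opair x y ∈ f) /\
  (forall x, x ∈ A -> forall y, y ∈ R -> forall x', x' ∈ A -> forall y', y' ∈ R ->
     opair x y ∈ f -> opair x' y' ∈ f -> (x = x' <-> y = y') /\ (x ~ x' <-> y ~ y')).

Lemma mem_copies A : A ∈ PR <-> M A /\ subset A R /\ exists f, M f /\ biso f A.
Proof.
  unfold copies. rewrite mem_sep, mem_pow. split.
  - intros [HA [MA [f [Mf [[[[H1 H2] H3] H4] H5]]]]]. split; auto. split; auto.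
    exists f. split; auto.
    assert (H1' : forall x y, opair x y ∈ f -> x ∈ A /\ y ∈ R).
    { intros x y Hxy. destruct (H1 _ Hxy) as [x' [y' [Hx [Hy Ez]]]].
      apply opair_inj in Ez. destruct Ez as [-> ->]. auto. }
    split; [|split].
    + intros x Hx. destruct (H2 x Hx) as [y [Hy _]]. exists y. split; auto. now apply H1' in Hy.
    + intros y Hy. destruct (H4 y Hy) as [x Hx]. exists x. split; auto. now apply H1' in Hx.
    + intros x Hx y Hy x' Hx' y' Hy' A1 A2. split; [split|].
      * intros <-. destruct (H2 x Hx) as [y0 [_ Hu]]. rewrite <- (Hu y), <- (Hu y'); auto.
      * intros <-. eapply H3; eauto.
      * apply H5; auto.
  - intros [MA [HA [f [Mf [H1 [H2 H3]]]]]]. split; auto. split; auto.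
    exists (sep (prod A R) (fun z => z ∈ f)). split.
    { pose proof MR. apply (M_sep HM); [in_M|]. dfs. }
    assert (Hf : forall x y, opair x y ∈ sep (prod A R) (fun z => z ∈ f) <->
      x ∈ A /\ y ∈ R /\ opair x y ∈ f).
    { intros x y. rewrite mem_sep, opair_prod. tauto. }
    split; [split; [split; [split|]|]|].
    + intros z Hz. apply mem_sep in Hz. destruct Hz as [Hz _]. apply mem_prod in Hz.
      destruct Hz as [x [Hx [y [Hy ->]]]]. eauto.
    + intros x Hx. destruct (H1 x Hx) as [y [Hy Hxy]]. exists y. split; [apply Hf; auto|].
      intros y' Hy'. apply Hf in Hy'. destruct Hy' as [_ [Hy' Hxy']].
      now apply (H3 x Hx y Hy x Hx y' Hy').
    + intros x x' y Hx Hx'. apply Hf in Hx, Hx'. destruct Hx as [Hx [Hy A1]], Hx' as [Hx' [_ A2]].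
      now apply (H3 x Hx y Hy x' Hx' y Hy).
    + intros y Hy. destruct (H2 y Hy) as [x [Hx Hxy]]. exists x. apply Hf; auto.
    + intros u v u' v' Hu Hv. apply Hf in Hu, Hv.
      destruct Hu as [Hu [Hu' A1]], Hv as [Hv [Hv' A2]].
      now apply (H3 u Hu u' Hu' v Hv v' Hv').
Qed.

Lemma df_biso : df M (fun e => biso (e 0) (e 1)).
Proof. pose proof MR. pose proof ME. unfold biso. dfs. Qed.

Lemma M_copies : M PR.
Proof.
  pose proof MR. pose proof df_biso.
  replace PR with (sep (powM M R) (fun A => exists f, M f /\ biso f A)).
  - apply (M_sep HM); [in_M|]. dfs.
  - apply mem_ext. intros A. rewrite mem_sep, mem_powM, mem_copies. tauto.
Qed.

Lemma copy_sub A : A ∈ PR -> subset A R.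
Proof. intros H. now apply mem_copies in H. Qed.

Lemma copy_M A : A ∈ PR -> M A.
Proof. intros H. now apply mem_copies in H. Qed.

Lemma EP_copy A : A ∈ PR -> EP A.
Proof.
  intros HA. apply mem_copies in HA. destruct HA as [MA [HAR [f [Mf [H1 [H2 H3]]]]]].
  intros l k Hl.
  pose (phi := fun x => epsilon (inhabits R) (fun y => y ∈ R /\ opair x y ∈ f)).
  assert (Hphi : forall x, x ∈ A -> phi x ∈ R /\ opair x (phi x) ∈ f).
  { intros x Hx. apply (epsilon_spec (inhabits R) (fun y => y ∈ R /\ opair x y ∈ f)). auto. }
  destruct (@EP_R (map phi l) (fun r => exists h, In h l /\ r = phi h /\ k h)) as [w [Hw [Hn Hk]]].
  - intros h Hh. apply in_map_iff in Hh. destruct Hh as [x [<- Hx]]. apply Hphi; auto.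
  - destruct (H2 w Hw) as [v [Hv Hvw]]. exists v. split; auto. split.
    + intros Hin. apply Hn. apply in_map_iff. exists v. split; auto.
      destruct (Hphi v Hv). now apply (H3 v Hv (phi v) ltac:(auto) v Hv w Hw).
    + intros h Hh. destruct (Hphi h (Hl h Hh)) as [P1 P2].
      destruct (H3 v Hv w Hw h (Hl h Hh) (phi h) P1 Hvw P2) as [_ ->].
      rewrite Hk by (now apply in_map). split; eauto.
      intros [h' [Hh' [Eh Hk']]]. replace h with h'; auto.
      destruct (Hphi h' (Hl h' Hh')) as [P3 P4].
      now apply (H3 h' (Hl h' Hh') (phi h') P3 h (Hl h Hh) (phi h) P1).
Qed.

Lemma EP_two_lists l1 l2 (k1 k2 : U -> Prop) A : EP A ->
  (forall h, In h (l1 ++ l2) -> h ∈ A) -> (forall h, In h l1 -> In h l2 -> False) ->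
  exists v, v ∈ A /\ ~ In v (l1 ++ l2) /\ (forall h, In h l1 -> (v ~ h <-> k1 h)) /\
    (forall h, In h l2 -> (v ~ h <-> k2 h)).
Proof.
  intros HA Hl Hd.
  destruct (HA (l1 ++ l2) (fun h => (In h l1 /\ k1 h) \/ (In h l2 /\ k2 h)) Hl) as [v [Hv [Hn Hk]]].
  exists v. split; auto. split; auto.
  split; intros h Hh; rewrite Hk by (apply in_or_app; auto); specialize (Hd h); tauto.
Qed.

Definition type_set A l k : U :=
  sep A (fun v => ~ In v l /\ forall h, In h l -> (v ~ h <-> k h)).

Lemma M_type_set A l k : M A -> (forall h, In h l -> h ∈ A) -> M (type_set A l k).
Proof.
  intros MA Hl. pose proof ME.
  assert (Ml : forall h, In h l -> M h) by (intros h Hh; exact (M_trans HM MA (Hl h Hh))).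
  apply (M_sep HM); auto. apply df_and; [apply df_not, (df_In HM); auto; dfs|].
  apply (df_list_all HM) with (phi := fun h e => opair (e 0) h ∈ E <-> k h).
  intros h Hh. pose proof (Ml h Hh). dfs.
Qed.

Lemma EP_type_set A l k : EP A -> (forall h, In h l -> h ∈ A) -> EP (type_set A l k).
Proof.
  intros HA Hl l' k' Hl'.
  destruct (@EP_two_lists l l' k k' A HA) as [v [Hv [Hn [H1 H2]]]].
  - intros h Hh. apply in_app_or in Hh. destruct Hh as [Hh|Hh]; auto.
    apply Hl' in Hh. now apply mem_sep in Hh.
  - intros h Hh Hh'. apply Hl' in Hh'. apply mem_sep in Hh'. tauto.
  - rewrite in_app_iff in Hn. exists v. split; [|split; auto; tauto].
    apply mem_sep. repeat split; auto; now apply H1.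
Qed.

(** Finite sets of vertices are taken to be initial segments of the enumeration [c], so that one
    natural number names such a set inside M. *)
Definition below_code (c b n : U) := exists m, m ∈ n /\ opair b m ∈ c.

Lemma below_code_list (c : U) (n : nat) :
  (forall x x' m, opair x m ∈ c -> opair x' m ∈ c -> x = x') ->
  exists l, (forall b, In b l -> b ∈ R) /\
    forall b, b ∈ R -> below_code c b (num n) -> In b l.
Proof.
  intros Hc. induction n as [|n [l [Hl1 Hl2]]].
  - exists nil. split; [intros b []|]. intros b _ [m [Hm _]]. now apply mem_emp in Hm.
  - assert (Hn : forall b, below_code c b (num (S n)) -> below_code c b (num n) \/ opair b (num n) ∈ c).
    { intros b [m [Hm Hbm]]. simpl in Hm. apply mem_succ in Hm.
      destruct Hm as [Hm| ->]; auto. left. exists m. auto. }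
    destruct (classic (exists b, b ∈ R /\ opair b (num n) ∈ c)) as [[b0 [Hb0 Hcb]]|Hno].
    + exists (b0 :: l). split; [intros b [<-|Hb]; auto|].
      intros b Hb Hbn. destruct (Hn b Hbn); [right; auto|left; eauto].
    + exists l. split; auto. intros b Hb Hbn. destruct (Hn b Hbn); auto.
      exfalso. eauto.
Qed.

(** Back-and-forth between [A] and [R], carried out in M: the pieces are pairs, coherence says that
    two pairs form a partial isomorphism, and the tasks put the vertex with code n into the domain
    or into the range. *)
Lemma copy_of_EP A : M A -> subset A R -> EP A -> A ∈ PR.
Proof.
  intros MA HAR HA. apply mem_copies. split; auto. split; auto.
  pose proof MR. pose proof ME.
  destruct code_exists as [c [Mc [Hc1 [Hc2 _]]]].
  pose (X := prod A R).
  pose (theta := fun z z' => forall x, x ∈ A -> forall y, y ∈ R -> z = opair x y ->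
     forall x', x' ∈ A -> forall y', y' ∈ R -> z' = opair x' y' ->
     (x = x' <-> y = y') /\ (x ~ x' <-> y ~ y')).
  pose (psi1 := fun n z => exists x, x ∈ A /\ exists y, y ∈ R /\ z = opair x y /\ opair x n ∈ c).
  pose (psi2 := fun n z => exists x, x ∈ A /\ exists y, y ∈ R /\ z = opair x y /\ opair y n ∈ c).
  assert (Hth : forall x y x' y', theta (opair x y) (opair x' y') ->
     x ∈ A -> y ∈ R -> x' ∈ A -> y' ∈ R -> (x = x' <-> y = y') /\ (x ~ x' <-> y ~ y')).
  { intros x y x' y' Ht ? ? ? ?. apply Ht; auto. }
  assert (Hth2 : forall x y x' y', (x = x' <-> y = y') /\ (x ~ x' <-> y ~ y') ->
    theta (opair x y) (opair x' y')).
  { intros x y x' y' Ht a _ b _ E1 a' _ b' _ E2. apply opair_inj in E1, E2.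
    destruct E1 as [<- <-], E2 as [<- <-]. auto. }
  assert (Hlist : forall l z, theta_ok X theta l -> In z l -> exists x y, z = opair x y /\ x ∈ A /\ y ∈ R).
  { intros l z [Hl _] Hz. apply Hl in Hz. apply mem_prod in Hz. destruct Hz as [x [? [y [? ?]]]]. eauto. }
  assert (Hext : forall l x y, theta_ok X theta l -> x ∈ A -> y ∈ R ->
    (forall x' y', In (opair x' y') l -> (x = x' <-> y = y') /\ (x ~ x' <-> y ~ y')) ->
    theta_ok X theta (opair x y :: l)).
  { intros l x y Hok Hx Hy Hnew. split.
    - intros z [<-|Hz]; [now apply opair_prod|]. now apply Hok.
    - intros z z' [<-|Hz] [<-|Hz'].
      + apply Hth2. split; [tauto|]. split; intros Ha; now apply adj_irrefl in Ha.
      + destruct (Hlist _ _ Hok Hz') as [x' [y' [-> [Hx' Hy']]]]. apply Hth2. auto.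
      + destruct (Hlist _ _ Hok Hz) as [x' [y' [-> [Hx' Hy']]]]. apply Hth2.
        destruct (Hnew _ _ Hz) as [[N1 N2] N3]. rewrite (adj_sym x' x), (adj_sym y' y). split; [split; intros; symmetry; auto|exact N3].
      + now apply Hok. }
  destruct (@M_generic_clique U M HM X theta psi1 psi2) as [g [Mg [HgX [Hg Hpsi]]]].
  - unfold X. in_M.
  - unfold theta. dfs.
  - unfold psi1. dfs.
  - unfold psi2. dfs.
  - intros l n Hok [z [_ [x [Hx [y0 [_ [_ Hn]]]]]]].
    destruct (classic (exists y, In (opair x y) l)) as [[y Hy]|Hno].
    + exists (opair x y). destruct (Hlist _ _ Hok Hy) as [x' [y' [Ez [_ Hy']]]].
      apply opair_inj in Ez. destruct Ez as [_ ->]. split; [exists x; eauto 10|].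
      apply Hext; auto. intros x2 y2 H2. destruct (Hlist _ _ Hok H2) as [x3 [y3 [Ez [A3 B3]]]].
      apply opair_inj in Ez. destruct Ez as [-> ->]. apply Hth; auto. now apply Hok.
    (* The partner of [x] must be adjacent to exactly those vertices already in the range whose
       partners are adjacent to [x]. *)
    + destruct (@EP_R (map (@osnd U) l) (fun y => exists x', In (opair x' y) l /\ x ~ x'))
        as [y [Hy [Hn' Hk]]].
      { intros h Hh. apply in_map_iff in Hh. destruct Hh as [z' [<- Hz']].
        destruct (Hlist _ _ Hok Hz') as [x3 [y3 [-> [A3 B3]]]]. now rewrite osnd_opair. }
      exists (opair x y). split; [exists x; eauto 10|]. apply Hext; auto.
      intros x' y' H'. assert (Hin : In y' (map (@osnd U) l)).
      { apply in_map_iff. exists (opair x' y'). split; auto. apply osnd_opair. }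
      split.
      * split; [intros <-; exfalso; eauto|intros <-; exfalso; auto].
      * rewrite (Hk y' Hin). split; eauto. intros [x2 [H2 Hx2]].
        replace x' with x2; auto.
        destruct (Hlist _ _ Hok H2) as [? [? [Ez [? ?]]]]. apply opair_inj in Ez. destruct Ez as [<- <-].
        destruct (Hlist _ _ Hok H') as [? [? [Ez [? ?]]]]. apply opair_inj in Ez. destruct Ez as [<- <-].
        apply (Hth x2 y' x' y'); auto. now apply Hok.
  - intros l n Hok [z [_ [x0 [_ [y [Hy [_ Hn]]]]]]].
    destruct (classic (exists x, In (opair x y) l)) as [[x Hx]|Hno].
    + exists (opair x y). destruct (Hlist _ _ Hok Hx) as [x' [y' [Ez [Hx' _]]]].
      apply opair_inj in Ez. destruct Ez as [-> _]. split; [exists x'; eauto 10|].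
      apply Hext; auto. intros x2 y2 H2. destruct (Hlist _ _ Hok H2) as [x3 [y3 [Ez [A3 B3]]]].
      apply opair_inj in Ez. destruct Ez as [-> ->]. apply Hth; auto. now apply Hok.
    + destruct (@HA (map (@ofst U) l) (fun x => exists y', In (opair x y') l /\ y ~ y'))
        as [x [Hx [Hn' Hk]]].
      { intros h Hh. apply in_map_iff in Hh. destruct Hh as [z' [<- Hz']].
        destruct (Hlist _ _ Hok Hz') as [x3 [y3 [-> [A3 B3]]]]. now rewrite ofst_opair. }
      exists (opair x y). split; [exists x; eauto 10|]. apply Hext; auto.
      intros x' y' H'. assert (Hin : In x' (map (@ofst U) l)).
      { apply in_map_iff. exists (opair x' y'). split; auto. apply ofst_opair. }
      split.
      * split; [intros <-; exfalso; auto|intros <-; exfalso; eauto].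
      * rewrite (Hk x' Hin). split; eauto. intros [y2 [H2 Hy2]].
        replace y' with y2; auto.
        destruct (Hlist _ _ Hok H2) as [? [? [Ez [? ?]]]]. apply opair_inj in Ez. destruct Ez as [<- <-].
        destruct (Hlist _ _ Hok H') as [? [? [Ez [? ?]]]]. apply opair_inj in Ez. destruct Ez as [<- <-].
        apply (Hth x' y2 x' y'); auto. now apply Hok.
  - exists g. split; auto.
    destruct (EP_R (l := nil) (fun _ => True)) as [r [Hr _]]; [simpl; tauto|].
    destruct (HA nil (fun _ => True)) as [a [Ha _]]; [simpl; tauto|].
    split; [|split].
    + intros x Hx. destruct (Hc1 x (HAR x Hx)) as [n Hn].
      destruct (proj1 (Hpsi n)) as [z [Hz [x' [Hx' [y [Hy [-> Hn']]]]]]].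
      { exists (opair x r). split; [now apply opair_prod|]. exists x; eauto 10. }
      replace x with x' by eauto. eauto.
    + intros y Hy. destruct (Hc1 y Hy) as [n Hn].
      destruct (proj2 (Hpsi n)) as [z [Hz [x [Hx [y' [Hy' [-> Hn']]]]]]].
      { exists (opair a y). split; [now apply opair_prod|]. exists a; eauto 10. }
      replace y with y' by eauto. eauto.
    + intros x Hx y Hy x' Hx' y' Hy' A1 A2. apply Hth; auto.
Qed.

Lemma copy_type_set A l k : A ∈ PR -> (forall h, In h l -> h ∈ A) -> type_set A l k ∈ PR.
Proof.
  intros HA Hl. apply copy_of_EP.
  - apply M_type_set; auto. now apply copy_M.
  - intros z Hz. apply mem_sep in Hz. apply (copy_sub HA). tauto.
  - apply EP_type_set; auto. now apply EP_copy.
Qed.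

Lemma R_copy : R ∈ PR.
Proof. apply copy_of_EP; [exact MR|intros z; auto|exact EP_R]. Qed.

Lemma copy_nonempty A : A ∈ PR -> exists v, v ∈ A.
Proof.
  intros HA. destruct (EP_copy HA (l := nil) (fun _ => True)) as [v [Hv _]]; [simpl; tauto|eauto].
Qed.

(** If the part of [A] inside [X] fails the extension property, some type over a finite list in that
    part is realized there by no vertex. All vertices of [A] of this type then avoid [X], and they
    form a copy. *)
Lemma copy_indivisible A X : A ∈ PR -> M X ->
  exists C, C ∈ PR /\ subset C A /\ (subset C X \/ forall v, v ∈ C -> v ∉ X).
Proof.
  intros HA MX. pose proof (copy_M HA) as MA.
  destruct (classic (EP (sep A (fun v => v ∈ X)))) as [Hep|Hno].
  - exists (sep A (fun v => v ∈ X)). split; [|split].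
    + apply copy_of_EP; auto.
      * apply (M_sep HM); auto. dfs.
      * intros z Hz. apply mem_sep in Hz. apply (copy_sub HA). tauto.
    + intros z Hz. apply mem_sep in Hz. tauto.
    + left. intros z Hz. apply mem_sep in Hz. tauto.
  - unfold EP in Hno. apply not_all_ex_not in Hno. destruct Hno as [l Hno].
    apply not_all_ex_not in Hno. destruct Hno as [k Hno]. apply imply_to_and in Hno.
    destruct Hno as [Hl Hno].
    exists (type_set A l k). split; [|split].
    + apply copy_type_set; auto. intros h Hh. apply Hl in Hh. apply mem_sep in Hh. tauto.
    + intros z Hz. apply mem_sep in Hz. tauto.
    + right. intros v Hv HvX. apply Hno. exists v. apply mem_sep in Hv. rewrite mem_sep. tauto.
Qed.

Lemma copy_avoid A v : A ∈ PR -> v ∈ R -> exists C, C ∈ PR /\ subset C A /\ v ∉ C.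
Proof.
  intros HA Hv. destruct (classic (v ∈ A)) as [Hin|Hn].
  - exists (type_set A (v :: nil) (fun _ => True)). split; [|split].
    + apply copy_type_set; auto. intros h [<-|[]]; auto.
    + intros z Hz. apply mem_sep in Hz. tauto.
    + intros Hz. apply mem_sep in Hz. simpl in Hz. tauto.
  - exists A. split; auto. split; auto. intros z; auto.
Qed.

(** * Neighbourhoods and twinned families *)

Definition nbhd p : U := rado_set R E (sing p) (sing p).

Lemma mem_nbhd p v : v ∈ nbhd p <-> v ∈ R /\ v <> p /\ v ~ p.
Proof.
  unfold nbhd, rado_set. rewrite mem_sep. rewrite mem_sing. split.
  - intros [H1 [H2 [H3 _]]]. split; auto. split; auto. apply H3. now apply mem_sing.
  - intros [H1 [H2 H3]]. split; auto. split; auto. split.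
    + intros k Hk. apply mem_sing in Hk. now subst.
    + intros h Hh Hn. tauto.
Qed.

Lemma nbhd_copy p : p ∈ R -> nbhd p ∈ PR.
Proof.
  intros Hp. replace (nbhd p) with (type_set R (p :: nil) (fun _ => True)).
  - apply copy_type_set; [exact R_copy|]. intros h [<-|[]]; auto.
  - apply mem_ext. intros v. unfold type_set. rewrite mem_sep, mem_nbhd. simpl. split.
    + intros [H1 [H2 H3]]. split; auto. split; [intros ->; tauto|]. apply H3; auto.
    + intros [H1 [H2 H3]]. split; auto. split; [intros [->|[]]; tauto|].
      intros h [<-|[]]. tauto.
Qed.

(* Away from i, the first components of tw form two families of vertices, told
   apart by adjacency to i; two vertices with distinct labels, of the same or of
   different families, are adjacent exactly when their labels are. *)
Definition is_twin i tw :=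
  (forall y l : U, opair y l ∈ tw -> y ∈ R /\ l ∈ R /\ y <> i) /\
  (forall y l y' l' : U, opair y l ∈ tw -> opair y' l' ∈ tw ->
     (y = y' -> l = l') /\ (l <> l' -> (y ~ y' <-> l ~ l')) /\
     (l = l' -> (y ~ i <-> y' ~ i) -> y = y')) /\
  (forall (l : U) (eps : Prop), l ∈ R -> exists y, opair y l ∈ tw /\ (y ~ i <-> eps)).

(** Any vertex [i] serves. The back-and-forth runs through the labels, with one task for each side
    of [i]. The vertices found so far differ from [i], so adjacency to [i] and adjacency to them can
    be prescribed independently. *)
Lemma twin_exists : exists i tw, i ∈ R /\ M tw /\ is_twin i tw.
Proof.
  pose proof MR as MR'. pose proof ME.
  destruct code_exists as [c [Mc [Hc1 [Hc2 _]]]].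
  destruct (copy_nonempty R_copy) as [i Hi]. exists i.
  pose proof (M_trans HM MR' Hi) as Mi.
  pose (X := sep (prod R R) (fun z => exists y, y ∈ R /\ exists l : U, l ∈ R /\ z = opair y l /\ y <> i)).
  assert (HX : forall y l : U, opair y l ∈ X <-> y ∈ R /\ l ∈ R /\ y <> i).
  { intros y l. unfold X. rewrite mem_sep, opair_prod. split.
    - intros [_ [y' [? [l' [? [Ez ?]]]]]]. apply opair_inj in Ez. destruct Ez as [-> ->]. auto.
    - intros [? [? ?]]. split; auto. exists y. split; auto. exists l; auto. }
  pose (T := fun y l y' l' : U => (y = y' -> l = l') /\ (l <> l' -> (y ~ y' <-> l ~ l')) /\
     (l = l' -> (y ~ i <-> y' ~ i) -> y = y')).
  pose (theta := fun z z' => forall y, y ∈ R -> forall l : U, l ∈ R -> z = opair y l ->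
     forall y', y' ∈ R -> forall l' : U, l' ∈ R -> z' = opair y' l' -> T y l y' l').
  pose (psi := fun (eps : Prop) n z => exists y, y ∈ R /\ exists l : U, l ∈ R /\ z = opair y l /\
     opair l n ∈ c /\ (y ~ i <-> eps)).
  assert (Hth : forall x y x' y', theta (opair x y) (opair x' y') ->
     x ∈ R -> y ∈ R -> x' ∈ R -> y' ∈ R -> T x y x' y').
  { intros x y x' y' Ht ? ? ? ?. apply Ht; auto. }
  assert (Hth2 : forall x y x' y', T x y x' y' -> theta (opair x y) (opair x' y')).
  { intros x y x' y' Ht a _ b _ E1 a' _ b' _ E2. apply opair_inj in E1, E2.
    destruct E1 as [<- <-], E2 as [<- <-]. auto. }
  assert (Hlist : forall l z, theta_ok X theta l -> In z l -> exists x y, z = opair x y /\ x ∈ R /\ y ∈ R /\ x <> i).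
  { intros l z [Hl _] Hz. pose proof (Hl z Hz) as Hz'. apply mem_sep in Hz'.
    destruct Hz' as [_ [x [? [y [? [? ?]]]]]]. eauto 10. }
  assert (Htask : forall eps l n, theta_ok X theta l -> (exists z, z ∈ X /\ psi eps (num n) z) ->
     exists z, psi eps (num n) z /\ theta_ok X theta (z :: l)).
  { intros eps l n Hok [z [_ [y0 [_ [a [Ha [_ [Hn _]]]]]]]].
    destruct (classic (exists y, In (opair y a) l /\ (y ~ i <-> eps))) as [[y [Hy Hye]]|Hno].
    - exists (opair y a). destruct (Hlist _ _ Hok Hy) as [y' [a' [Ez [Hy' [_ Hyi]]]]].
      apply opair_inj in Ez. destruct Ez as [<- <-].
      split; [exists y; eauto 10|]. split.
      + intros z' [<-|Hz']; now apply Hok.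
      + intros z1 z2 [<-|Hz1] [<-|Hz2]; now apply Hok.
    (* A vertex with label [a] is chosen on side [eps] of [i], its adjacency to all earlier vertices
       of both families being dictated by the labels. *)
    - destruct (@EP_two_lists (i :: nil) (map (@ofst U) l) (fun _ => eps)
        (fun y' => exists l', In (opair y' l') l /\ a ~ l') R EP_R) as [y [Hy [Hny [He Hk]]]].
      { intros h [<-|Hh]; auto. apply in_map_iff in Hh. destruct Hh as [z' [<- Hz']].
        destruct (Hlist _ _ Hok Hz') as [x3 [y3 [-> [A3 [B3 C3]]]]]. now rewrite ofst_opair. }
      { intros h [<-|[]] Hh. apply in_map_iff in Hh. destruct Hh as [z' [Eh Hz']].
        destruct (Hlist _ _ Hok Hz') as [x3 [y3 [-> [A3 [B3 C3]]]]]. rewrite ofst_opair in Eh. auto. }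
      specialize (He i (or_introl eq_refl)). simpl in Hny.
      assert (Hyi : y <> i) by (intros ->; tauto).
      exists (opair y a). split; [exists y; eauto 10|].
      assert (Hnew : forall y' l' : U, In (opair y' l') l -> T y a y' l').
      { intros y' l' H'. assert (Hin : In y' (map (@ofst U) l)).
        { apply in_map_iff. exists (opair y' l'). split; auto. apply ofst_opair. }
        split; [intros <-; tauto|]. split.
        - intros _. rewrite (Hk y' Hin). split; eauto. intros [l2 [H2 Hl2]].
          replace l' with l2; auto.
          destruct (Hlist _ _ Hok H2) as [? [? [Ez [? [? ?]]]]]. apply opair_inj in Ez. destruct Ez as [<- <-].
          destruct (Hlist _ _ Hok H') as [? [? [Ez [? [? ?]]]]]. apply opair_inj in Ez. destruct Ez as [<- <-].
          apply (Hth y' l2 y' l'); auto. now apply Hok.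
        - intros <- Hyy. exfalso. apply Hno. exists y'. split; auto. tauto. }
      split.
      + intros z' [<-|Hz']; [now apply HX|now apply Hok].
      + intros z1 z2 [<-|Hz1] [<-|Hz2].
        * apply Hth2. unfold T. tauto.
        * destruct (Hlist _ _ Hok Hz2) as [y' [l' [-> _]]]. apply Hth2. auto.
        * destruct (Hlist _ _ Hok Hz1) as [y' [l' [-> _]]]. apply Hth2.
          destruct (Hnew _ _ Hz1) as [T1 [T2 T3]]. unfold T.
          rewrite (adj_sym y' y), (adj_sym l' a). split; [intros; symmetry; auto|].
          split; [intros; apply T2; auto|]. intros Hl Hyy. symmetry. apply T3; auto. tauto.
        * now apply Hok. }
  destruct (@M_generic_clique U M HM X theta (psi True) (psi False)) as [g [Mg [HgX [Hg Hpsi]]]]; auto.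
  - apply (M_sep HM); [in_M|]. dfs.
  - unfold theta, T. dfs.
  - unfold psi. dfs.
  - unfold psi. dfs.
  - exists g. split; auto. split; auto. split; [|split].
    + intros y l Hyl. apply HX, HgX, Hyl.
    + intros y l y' l' A1 A2. pose proof (proj1 (HX _ _) (HgX _ A1)).
      pose proof (proj1 (HX _ _) (HgX _ A2)). apply Hth; tauto || now apply Hg.
    + intros l eps Hl. destruct (Hc1 l Hl) as [n Hn].
      assert (Hex : forall eps', exists y, y ∈ R /\ y <> i /\ (y ~ i <-> eps')).
      { intros eps'. destruct (@EP_R (i :: nil) (fun _ => eps')) as [y [Hy [Hy' Hk]]].
        - intros h [<-|[]]; auto.
        - exists y. split; auto. simpl in Hy'. split; [intros ->; tauto|]. apply Hk. simpl; auto. }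
      destruct (classic eps) as [He|He].
      * destruct (proj1 (Hpsi n)) as [z [Hz [y [Hy [l' [Hl' [-> [Hn' Hye]]]]]]]].
        { destruct (Hex True) as [y [Hy [Hyi Hye]]]. exists (opair y l). split; [now apply HX|].
          exists y. split; auto. exists l. auto. }
        exists y. replace l with l' by eauto. tauto.
      * destruct (proj2 (Hpsi n)) as [z [Hz [y [Hy [l' [Hl' [-> [Hn' Hye]]]]]]]].
        { destruct (Hex False) as [y [Hy [Hyi Hye]]]. exists (opair y l). split; [now apply HX|].
          exists y. split; auto. exists l. auto. }
        exists y. replace l with l' by eauto. tauto.
Qed.

End Rado.

(** * Forcing *)

Lemma name_wf (U : universe) : well_founded (fun r s : U => exists p, opair r p ∈ s).
Proof.
  apply wf_incl with (clos_trans U (@mem U)).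
  - intros r s [p Hp]. apply t_trans with (sing r).
    + apply t_step. now apply mem_sing.
    + apply t_trans with (opair r p); apply t_step; auto.
      unfold opair. apply mem_upair. auto.
  - apply wf_clos_trans, mem_wf.
Qed.

Lemma is_val_fun (U : universe) (G s y y' : U) : is_val G s y -> is_val G s y' -> y = y'.
Proof.
  revert y y'. induction (name_wf s) as [s _ IH].
  assert (A : forall y y' z, is_val G s y -> is_val G s y' -> z ∈ y -> z ∈ y').
  { intros y y' z Hy Hy' Hz. destruct Hy as [s y Hy1 _], Hy' as [s y' _ Hy2].
    destruct (Hy1 z Hz) as [r [p [Hp [Hr Hv]]]].
    destruct (Hy2 r p Hp Hr) as [z' [Hz' Hv']].
    replace z with z'; auto. apply (IH r); eauto. }
  intros y y' H H'. apply mem_ext. intros z. split; eauto.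
Qed.

Section Forcing.
Context {U : universe} (M : U -> Prop) (HM : transitive_model M).
Context (P : U) (MP : M P) (G : U) (HG : is_generic M P subset G).
Implicit Types (C D W T r s v p : U).

Lemma G_sub C : C ∈ G -> C ∈ P.
Proof. apply (filter_sub (proj1 HG)). Qed.

Lemma G_common C D : C ∈ G -> D ∈ G -> exists r, r ∈ G /\ subset r C /\ subset r D.
Proof. apply (filter_dir (proj1 HG)). Qed.

(** Density is known only below [C]. Adding the conditions incompatible with [C] gives a dense set
    of M, and no such condition lies in [G] together with [C]. *)
Lemma generic_below C (Q : U -> Prop) : C ∈ G -> df M (fun e => Q (e 0)) ->
  (forall D, D ∈ P -> subset D C -> exists r, r ∈ P /\ subset r D /\ Q r) ->
  exists r, r ∈ G /\ Q r.
Proof.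
  intros HC HQ Hd. pose proof (M_trans HM MP (G_sub HC)) as MC.
  destruct (proj2 HG (sep P (fun D => Q D \/ ~ exists r, r ∈ P /\ subset r D /\ subset r C)))
    as [D [HD HDG]].
  - apply (M_sep HM); auto. dfs.
  - split; [intros z Hz; now apply mem_sep in Hz|]. intros D HD.
    destruct (classic (exists r, r ∈ P /\ subset r D /\ subset r C)) as [[r [Hr [H1 H2]]]|Hn].
    + destruct (Hd r Hr H2) as [q [Hq [H3 HQq]]]. exists q. split; [apply mem_sep; auto|].
      intros z Hz. auto.
    + exists D. split; [apply mem_sep; auto|]. intros z; auto.
  - apply mem_sep in HD. destruct HD as [_ [HD|HD]]; [eauto|].
    exfalso. apply HD. destruct (G_common HDG HC) as [r [Hr [H1 H2]]].
    exists r. split; auto. now apply G_sub.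
Qed.

(* C forces the value of s to be the ground model set v, the pairs already
   decided being those of W. *)
Definition forces_step W C s v :=
  (forall y, y ∈ v -> forall C1, C1 ∈ P -> subset C1 C -> exists C2, C2 ∈ P /\ subset C2 C1 /\
     exists r, M r /\ exists p, p ∈ P /\ opair r p ∈ s /\ subset C2 p /\ opair C2 (opair r y) ∈ W) /\
  (forall r, M r -> forall p, p ∈ P -> opair r p ∈ s ->
     forall C1, C1 ∈ P -> subset C1 C -> subset C1 p ->
     exists C2, C2 ∈ P /\ subset C2 C1 /\ exists y, y ∈ v /\ opair C2 (opair r y) ∈ W).

Lemma transitive_name T r p s : transitive_set T -> s ∈ T -> opair r p ∈ s -> r ∈ T.
Proof.
  intros HT Hs Hr. apply (HT (sing r)); [|now apply mem_sing].
  apply (HT (opair r p)); [eapply HT; eauto|]. unfold opair. apply mem_upair. auto.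
Qed.

Lemma forces_step_mono T W W' C s v : transitive_set T -> s ∈ T -> v ∈ T ->
  (forall C r y, C ∈ P -> r ∈ T -> y ∈ T -> opair C (opair r y) ∈ W -> opair C (opair r y) ∈ W') ->
  forces_step W C s v -> forces_step W' C s v.
Proof.
  intros HT Hs Hv HW [H1 H2]. split.
  - intros y Hy C1 HC1 Hsub. destruct (H1 y Hy C1 HC1 Hsub) as [C2 [HC2 [Hsub2 [r [Mr [p [Hp [Hr [Hsub3 H]]]]]]]]].
    exists C2. split; auto. split; auto. exists r. split; auto. exists p. split; auto. split; auto. split; auto.
    apply HW; auto; [exact (transitive_name HT Hs Hr)|exact (HT v Hv y Hy)].
  - intros r Mr p Hp Hr C1 HC1 Hs1 Hs2. destruct (H2 r Mr p Hp Hr C1 HC1 Hs1 Hs2) as [C2 [HC2 [Hsub [y [Hy H]]]]].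
    exists C2. split; auto. split; auto. exists y. split; auto.
    apply HW; auto; [exact (transitive_name HT Hs Hr)|exact (HT v Hv y Hy)].
Qed.

(* forces_step is monotone in W, so its greatest fixed point over a transitive
   set replaces the usual recursion on names. *)
Lemma forces_exists T : M T -> transitive_set T -> exists W, M W /\
  forall C s v, C ∈ P -> s ∈ T -> v ∈ T -> (opair C (opair s v) ∈ W <-> forces_step W C s v).
Proof.
  intros MT HT.
  pose (X := prod P (prod T T)).
  pose (post := fun W => forall C, C ∈ P -> forall s, s ∈ T -> forall v, v ∈ T ->
    opair C (opair s v) ∈ W -> forces_step W C s v).
  pose (W := sep X (fun z => exists W', M W' /\ (post W' /\ z ∈ W'))).
  assert (HX : forall C s v, C ∈ P -> s ∈ T -> v ∈ T -> opair C (opair s v) ∈ X).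
  { intros. apply opair_prod. split; auto. now apply opair_prod. }
  assert (MW : M W).
  { apply (M_sep HM); [unfold X; in_M|]. unfold post, forces_step. dfs. }
  assert (H1 : forall C s v, C ∈ P -> s ∈ T -> v ∈ T -> opair C (opair s v) ∈ W -> forces_step W C s v).
  { intros C s v HC Hs Hv H. apply mem_sep in H. destruct H as [_ [W' [MW' [Hp H]]]].
    apply (forces_step_mono (T := T) (W := W')); auto.
    intros C' r y HC' Hr Hy H'. apply mem_sep. split; eauto. }
  exists W. split; auto. intros C s v HC Hs Hv. split; auto. intros H.
  (* As in the Knaster-Tarski argument, one further step applied to [W] gives [W2], which extends
     [W] and is therefore again a post-fixed point; hence it is contained in [W]. *)
  pose (W2 := sep X (fun z => exists C, C ∈ P /\ exists s, s ∈ T /\ exists v, v ∈ T /\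
    z = opair C (opair s v) /\ forces_step W C s v)).
  assert (H2 : forall C s v, C ∈ P -> s ∈ T -> v ∈ T -> (opair C (opair s v) ∈ W2 <-> forces_step W C s v)).
  { intros C' s' v' HC' Hs' Hv'. unfold W2. rewrite mem_sep. split.
    - intros [_ [a [_ [b [_ [c [_ [Ez Hf]]]]]]]]. apply opair_inj in Ez. destruct Ez as [-> Ez].
      apply opair_inj in Ez. destruct Ez as [-> ->]. auto.
    - intros Hf. split; auto. exists C'. split; auto. exists s'. split; auto. exists v'. auto. }
  apply mem_sep. split; auto. exists W2. split.
  - apply (M_sep HM); [unfold X; in_M|]. unfold forces_step. dfs.
  - split; [|now apply H2]. intros C' HC' s' Hs' v' Hv' H'. apply H2 in H'; auto.
    apply (forces_step_mono (T := T) (W := W)); auto.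
    intros a b c Ha Hb Hc Hw. apply H2; auto.
Qed.

Section Truth.
Variables (T W : U).
Hypotheses (MT : M T) (HT : transitive_set T) (MW : M W).
Hypothesis HW : forall C s v, C ∈ P -> s ∈ T -> v ∈ T ->
  (opair C (opair s v) ∈ W <-> forces_step W C s v).

Lemma forces_below C C' s v : C ∈ P -> C' ∈ P -> subset C' C -> s ∈ T -> v ∈ T ->
  opair C (opair s v) ∈ W -> opair C' (opair s v) ∈ W.
Proof.
  intros HC HC' Hsub Hs Hv H. apply HW; auto. apply HW in H; auto. destruct H as [H1 H2].
  assert (A : forall D, subset D C' -> subset D C) by (intros D HD z Hz; auto).
  split; [intros y Hy C1 HC1 Hs1; exact (H1 y Hy C1 HC1 (A _ Hs1))|].
  intros r Mr p Hp Hr C1 HC1 Hs1. exact (H2 r Mr p Hp Hr C1 HC1 (A _ Hs1)).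
Qed.

(** Induction on names from the fixed-point equation [HW]: it reduces the value of [s] to the values
    of the names occurring in [s], and genericity meets the dense sets mentioned in
    [forces_step]. *)
Lemma forcing_truth s : s ∈ T -> forall v, v ∈ T ->
  (is_val G s v <-> exists C, C ∈ G /\ opair C (opair s v) ∈ W).
Proof.
  induction (name_wf s) as [s _ IH]. intros Hs v Hv.
  pose proof (M_trans HM MT Hs) as Ms. pose proof (M_trans HM MT Hv) as Mv.
  assert (IHr : forall r p y, opair r p ∈ s -> y ∈ v ->
    (is_val G r y <-> exists C, C ∈ G /\ opair C (opair r y) ∈ W)).
  { intros r p y Hr Hy. apply IH; [eauto|exact (transitive_name HT Hs Hr)|exact (HT Hv Hy)]. }
  split.
  - intros Hval. destruct Hval as [s v Hv1 Hv2].
    destruct (filter_nonempty (proj1 HG)) as [C0 HC0].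
    (* Densely many conditions either force the value of [s] to be [v] or refute outright one
       instance of one of the two inclusions. A refuting condition in [G] contradicts the induction
       hypothesis. *)
    destruct (@generic_below C0 (fun C => opair C (opair s v) ∈ W \/
      (exists y, y ∈ v /\ ~ exists C2, C2 ∈ P /\ subset C2 C /\ exists r, M r /\ exists p, p ∈ P /\
          opair r p ∈ s /\ subset C2 p /\ opair C2 (opair r y) ∈ W) \/
      (exists r, M r /\ exists p, p ∈ P /\ opair r p ∈ s /\ subset C p /\
         ~ exists C2, C2 ∈ P /\ subset C2 C /\ exists y, y ∈ v /\ opair C2 (opair r y) ∈ W)))
      as [C [HC [H|[[y [Hy Hn]]|[r [Mr [p [Hp [Hr [Hsub Hn]]]]]]]]]]; auto.
    + dfs.
    + intros D HD _. apply NNPP. intros Hcon. apply Hcon. exists D. split; auto.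
      split; [intros z; auto|]. left. apply HW; auto. split.
      * intros y Hy C1 HC1 Hsub. apply NNPP. intros Hn. apply Hcon. exists C1. split; auto.
        split; auto. right. left. exists y. auto.
      * intros r Mr p Hp Hr C1 HC1 Hsub1 Hsub2. apply NNPP. intros Hn. apply Hcon. exists C1.
        split; auto. split; auto. right. right. exists r. split; auto. exists p. auto.
    + eauto.
    + exfalso. destruct (Hv1 y Hy) as [r [p [Hp [Hr Hry]]]].
      apply (IHr r p y Hr Hy) in Hry. destruct Hry as [C' [HC' H']].
      destruct (G_common HC HC') as [D [HD [D1 D2]]].
      destruct (G_common HD Hp) as [D' [HD' [D3 D4]]].
      apply Hn. exists D'. split; [now apply G_sub|]. split; [intros z Hz; auto|].
      assert (HrT : r ∈ T) by (exact (transitive_name HT Hs Hr)).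
      exists r. split; [exact (M_trans HM MT HrT)|]. exists p. split; [now apply G_sub|].
      split; auto. split; auto. apply (@forces_below C'); auto using G_sub; try exact (HT Hv Hy).
      intros z Hz; auto.
    + exfalso. assert (HpG : p ∈ G) by (eapply (filter_up (proj1 HG)); eauto).
      destruct (Hv2 r p HpG Hr) as [y [Hy Hry]].
      apply (IHr r p y Hr Hy) in Hry. destruct Hry as [C' [HC' H']].
      destruct (G_common HC HC') as [D [HD [D1 D2]]].
      apply Hn. exists D. split; [now apply G_sub|]. split; auto. exists y. split; auto.
      apply (@forces_below C'); auto using G_sub; [exact (transitive_name HT Hs Hr)|exact (HT Hv Hy)].
  - intros [C [HC H]]. apply HW in H; auto using G_sub. destruct H as [H1 H2].
    constructor.
    + intros y Hy. pose proof (M_trans HM Mv Hy) as My.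
      destruct (@generic_below C (fun C2 => exists r, M r /\ exists p, p ∈ P /\
          opair r p ∈ s /\ subset C2 p /\ opair C2 (opair r y) ∈ W))
        as [C2 [HC2 [r [Mr [p [Hp [Hr [Hsub H]]]]]]]]; auto.
      * dfs.
      * exists r, p. split; [eapply (filter_up (proj1 HG)); eauto|]. split; auto.
        apply (IHr r p y Hr Hy). eauto.
    + intros r p HpG Hr. destruct (G_common HC HpG) as [D [HD [D1 D2]]].
      assert (HrT : r ∈ T) by (exact (transitive_name HT Hs Hr)).
      pose proof (M_trans HM MT HrT) as Mr.
      destruct (@generic_below D (fun C2 => exists y, y ∈ v /\ opair C2 (opair r y) ∈ W))
        as [C2 [HC2 [y [Hy H]]]]; auto.
      * dfs.
      * intros D' HD' Hsub. apply (H2 r Mr p (G_sub HpG) Hr D' HD'); intros z Hz; auto.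
      * exists y. split; auto. apply (IHr r p y Hr Hy). eauto.
Qed.

End Truth.

(** [Dec] asks that [C] lie below some [p] with [opair s p] in [t] and force the value of this [s]
    to be the pair. Naming the witness [s] makes heredity and soundness immediate, while density is
    still guaranteed because [x] is total. *)
Lemma decisions_exist kappa t x : M kappa -> M t -> is_val G t x -> is_function x omega kappa ->
  exists Dec, M Dec /\
    (forall C C' n a, C' ∈ P -> subset C' C ->
       opair C (opair n a) ∈ Dec -> opair C' (opair n a) ∈ Dec) /\
    (forall C n a, C ∈ G -> opair C (opair n a) ∈ Dec -> opair n a ∈ x) /\
    exists A, A ∈ G /\ forall n, n ∈ omega -> forall C, C ∈ P -> subset C A ->
      exists C', C' ∈ P /\ subset C' C /\ exists a, a ∈ kappa /\ opair C' (opair n a) ∈ Dec.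
Proof.
  intros Mk Mt Hval [Hf1 Hf2].
  (* One transitive set has to contain both the names occurring in [t] and all possible values
     [opair n a]. *)
  destruct (@M_transitive_closure U M HM (opair t (prod omega kappa))) as [T [MT [HT [HT1 _]]]]; [in_M|].
  assert (HtT : t ∈ T).
  { apply (HT (sing t)); [|now apply mem_sing]. apply HT1. unfold opair. apply mem_upair. auto. }
  assert (HnaT : forall n a, n ∈ omega -> a ∈ kappa -> opair n a ∈ T).
  { intros n a Hn Ha. apply (HT (prod omega kappa)); [|now apply opair_prod].
    apply (HT (upair t (prod omega kappa))); [|apply mem_upair; auto].
    apply HT1. unfold opair. apply mem_upair. auto. }
  assert (HsT : forall s p, opair s p ∈ t -> s ∈ T) by (intros s p Hs; exact (transitive_name HT HtT Hs)).
  destruct (forces_exists MT HT) as [W [MW HW]].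
  pose (Q := fun C n a => exists s, M s /\ exists p, p ∈ P /\ opair s p ∈ t /\ subset C p /\
      opair C (opair s (opair n a)) ∈ W).
  pose (Dec := sep (prod P (prod omega kappa)) (fun z => exists C, C ∈ P /\ exists n, n ∈ omega /\
    exists a, a ∈ kappa /\ z = opair C (opair n a) /\ Q C n a)).
  assert (HDec : forall C n a, opair C (opair n a) ∈ Dec <-> C ∈ P /\ n ∈ omega /\ a ∈ kappa /\ Q C n a).
  { intros C n a. unfold Dec. rewrite mem_sep, !opair_prod. split.
    - intros [_ [C' [HC' [n' [Hn' [a' [Ha' [Ez HQ]]]]]]]]. apply opair_inj in Ez. destruct Ez as [-> Ez].
      apply opair_inj in Ez. destruct Ez as [-> ->]. auto.
    - intros [HC [Hn [Ha HQ]]]. split; auto. exists C. split; auto. exists n. split; auto.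
      exists a. auto. }
  assert (MDec : M Dec).
  { apply (M_sep HM); [in_M|]. unfold Q. dfs. }
  assert (Hmono : forall C C' n a, C' ∈ P -> subset C' C ->
       opair C (opair n a) ∈ Dec -> opair C' (opair n a) ∈ Dec).
  { intros C C' n a HC' Hsub H. apply HDec in H. destruct H as [HC [Hn [Ha [s [Ms [p [Hp [Hs [Hsp H]]]]]]]]].
    apply HDec. split; auto. split; auto. split; auto. exists s. split; auto. exists p.
    split; auto. split; auto. split; [intros z Hz; auto|].
    eapply (forces_below HW) with (C := C); eauto. }
  assert (Hsound : forall C n a, C ∈ G -> opair C (opair n a) ∈ Dec -> opair n a ∈ x).
  { intros C n a HC H. apply HDec in H. destruct H as [_ [Hn [Ha [s [Ms [p [Hp [Hs [Hsp H]]]]]]]]].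
    assert (HpG : p ∈ G) by (eapply (filter_up (proj1 HG)); eauto).
    assert (Hv : is_val G s (opair n a)).
    { apply (forcing_truth MT HT MW HW); eauto. }
    destruct Hval as [t x _ Hx]. destruct (Hx s p HpG Hs) as [y [Hy Hsy]].
    now rewrite (is_val_fun Hv Hsy). }
  exists Dec. split; auto. split; auto. split; auto.
  destruct (filter_nonempty (proj1 HG)) as [C0 HC0].
  (* Either decisions are dense below [A] for every n, or some n admits no decision below [A] at
     all; such conditions are dense. For [A] in [G] the second case is refuted by the actual value
     of [x] at n. *)
  destruct (@generic_below C0 (fun A =>
    (forall n, n ∈ omega -> forall C, C ∈ P -> subset C A ->
      exists C', C' ∈ P /\ subset C' C /\ exists a, a ∈ kappa /\ opair C' (opair n a) ∈ Dec) \/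
    (exists n, n ∈ omega /\ ~ exists C', C' ∈ P /\ subset C' A /\ exists a, a ∈ kappa /\ opair C' (opair n a) ∈ Dec)))
    as [A [HA [H|[n [Hn H]]]]]; auto.
  - dfs.
  - intros D HD _. apply NNPP. intros Hcon. apply Hcon. exists D. split; auto.
    split; [intros z; auto|]. left. intros n Hn C HC Hsub. apply NNPP. intros Hno.
    apply Hcon. exists C. split; auto. split; auto. right. eauto.
  - eauto.
  - exfalso. destruct (Hf2 n Hn) as [a [Ha _]].
    assert (Hak : a ∈ kappa).
    { destruct (Hf1 _ Ha) as [n' [a' [_ [Ha' Ez]]]]. apply opair_inj in Ez. now destruct Ez as [_ ->]. }
    destruct Hval as [t x Hx _].
    destruct (Hx _ Ha) as [s [p [Hp [Hs Hv]]]].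
    apply (forcing_truth MT HT MW HW) in Hv; eauto. destruct Hv as [C [HC HCW]].
    destruct (G_common HC HA) as [D [HD [D1 D2]]]. destruct (G_common HD Hp) as [D' [HD' [D3 D4]]].
    apply H. exists D'. split; [now apply G_sub|]. split; [intros z Hz; auto|]. exists a. split; auto.
    apply HDec. split; [now apply G_sub|]. split; auto. split; auto. exists s.
    split; [exact (M_trans HM MT (HsT _ _ Hs))|]. exists p. split; [now apply G_sub|].
    split; auto. split; auto. apply (forces_below HW) with (C := C); eauto using G_sub.
    intros z Hz; auto.
Qed.

End Forcing.

(** * Fusion *)

Section Fusion.
Context {U : universe} (M : U -> Prop) (HM : transitive_model M).
Context (R E : U) (HR : is_rado M R E).
Implicit Types (A B C x y b i h pi K m a s t : U).

Notation "x ~ y" := (opair x y ∈ E) (at level 70).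
Notation PR := (copies M R E).
Notation PW := (powM M (prod R R)).

Variables (c : U) (Mc : M c).
Hypothesis c_total : forall x, x ∈ R -> exists n, opair x (num n) ∈ c.
Hypothesis c_inj : forall x x' n, opair x n ∈ c -> opair x' n ∈ c -> x = x'.

Variables (Dec kappa : U) (MDec : M Dec) (Mkappa : M kappa).
Hypothesis Dec_mono : forall C C' n a, C' ∈ PR -> subset C' C ->
  opair C (opair n a) ∈ Dec -> opair C' (opair n a) ∈ Dec.

Variables (A : U) (HA : A ∈ PR).
Hypothesis Dec_dense : forall n, n ∈ omega -> forall C, C ∈ PR -> subset C A ->
  exists C', C' ∈ PR /\ subset C' C /\ exists a, a ∈ kappa /\ opair C' (opair n a) ∈ Dec.

Definition rg h b := exists x, x ∈ R /\ opair x b ∈ h.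
Definition dm h x := exists b, b ∈ R /\ opair x b ∈ h.
(** A set [K] of M codes a type over the range of [h]. Only its trace on the range counts, so
    finitely many codes represent all types. *)
Definition agree h y K := forall b, b ∈ R -> rg h b -> (y ~ b <-> b ∈ K).

(* h is a partial embedding of R into A and pi labels the vertices of A that
   remain available.  Among those of each type over the range of h every label
   occurs exactly once, and adjacency of vertices with distinct labels is read
   off the labels, even across different types. *)
Definition stage h pi :=
  (forall x, x ∈ R -> forall b, b ∈ R -> opair x b ∈ h ->
     forall x', x' ∈ R -> forall b', b' ∈ R -> opair x' b' ∈ h ->
     (x = x' <-> b = b') /\ (x ~ x' <-> b ~ b')) /\
  (forall x, x ∈ R -> forall b, b ∈ R -> opair x b ∈ h -> b ∈ A) /\
  (forall y, y ∈ R -> forall i, i ∈ R -> opair y i ∈ pi -> y ∈ A /\ ~ rg h y) /\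
  (forall y, y ∈ R -> forall i, i ∈ R -> opair y i ∈ pi ->
     forall y', y' ∈ R -> forall i', i' ∈ R -> opair y' i' ∈ pi ->
     (y = y' -> i = i') /\ (i <> i' -> (y ~ y' <-> i ~ i')) /\
     (i = i' -> (forall b, b ∈ R -> rg h b -> (y ~ b <-> y' ~ b)) -> y = y')) /\
  (forall K, M K -> forall i, i ∈ R -> exists y, y ∈ R /\ opair y i ∈ pi /\ agree h y K).

Definition decided h pi m K := exists a, a ∈ kappa /\ forall C, C ∈ PR ->
  (forall y, y ∈ C -> dm pi y /\ agree h y K) -> opair C (opair m a) ∈ Dec.

(** New vertices of the range come out of the pool and the pool only shrinks. Hence all vertices
    entering after a stage belong to the pool of that stage, and the decisions made there apply to
    them. *)
Definition extends h pi h' pi' :=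
  (forall z, z ∈ h -> z ∈ h') /\
  (forall x, x ∈ R -> forall b, b ∈ R -> opair x b ∈ h' -> opair x b ∈ h \/ dm pi b) /\
  (forall y, y ∈ R -> dm pi' y -> dm pi y).

Lemma PW_inv h x b : h ∈ PW -> opair x b ∈ h -> x ∈ R /\ b ∈ R.
Proof. intros Hh H. apply mem_powM in Hh. apply opair_prod. now apply Hh. Qed.

Lemma M_PW h : h ∈ PW -> M h.
Proof. intros Hh. now apply mem_powM in Hh. Qed.

Lemma PW_sep (Q : U -> Prop) : df M (fun e => Q (e 0)) -> sep (prod R R) Q ∈ PW.
Proof.
  intros HQ. pose proof (MR HR). apply mem_powM. split; [apply (M_sep HM); auto; in_M|].
  intros z Hz. now apply mem_sep in Hz.
Qed.

(** Restricted to the vertices of one type, the labelling [pi] is itself an isomorphism onto R. *)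
Lemma stage_type_copy h pi K : h ∈ PW -> pi ∈ PW -> stage h pi -> M K ->
  sep R (fun y => dm pi y /\ agree h y K) ∈ PR.
Proof.
  intros Hh Hpi [_ [_ [_ [S4 S5]]]] MK. pose proof (MR HR) as MR'. pose proof (M_PW Hh). pose proof (M_PW Hpi).
  assert (Hb : biso R E pi (sep R (fun y => dm pi y /\ agree h y K))).
  { split; [|split].
    - intros y Hy. apply mem_sep in Hy. destruct Hy as [_ [Hy _]]. exact Hy.
    - intros i Hi. destruct (S5 K MK i Hi) as [y [Hy [Hyi Hk]]]. exists y. split; auto.
      apply mem_sep. split; auto. split; auto. exists i. auto.
    - intros y Hy i Hi y' Hy' i' Hi' H1 H2. apply mem_sep in Hy, Hy'.
      destruct Hy as [Hy [_ Hk]], Hy' as [Hy' [_ Hk']].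
      destruct (S4 y Hy i Hi H1 y' Hy' i' Hi' H2) as [T1 [T2 T3]].
      assert (T4 : i = i' -> y = y').
      { intros Hii. apply T3; auto. intros b Hb Hr. rewrite (Hk b Hb Hr), (Hk' b Hb Hr). tauto. }
      split; [split; auto|]. destruct (classic (i = i')) as [Hii|Hii]; [|auto].
      pose proof (T4 Hii) as Hyy. subst. split; intros Hadj; exfalso; eapply (adj_irrefl HR); eauto. }
  apply (mem_copies HM HR). split; [|split].
  - pose proof (ME HR). apply (M_sep HM); auto. dfs.
  - intros z Hz. now apply mem_sep in Hz.
  - eauto.
Qed.

Lemma decided_weaken h pi pi' m K : (forall y, y ∈ R -> dm pi' y -> dm pi y) ->
  decided h pi m K -> decided h pi' m K.
Proof.
  intros Hsub [a [Ha H]]. exists a. split; auto. intros C HC HCy. apply H; auto.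
  intros y Hy. destruct (HCy y Hy). split; auto. apply Hsub; auto. exact (copy_sub HM HR HC Hy).
Qed.

(** Density gives a copy [C] inside the type coded by [K] that decides the value at [m]. In every
    type only the labels used by [C] are kept, and an isomorphism [g] of [C] onto R turns them into
    labels that exhaust R again. *)
Lemma stage_shrink h pi K m : h ∈ PW -> pi ∈ PW -> stage h pi -> M K -> m ∈ omega ->
  exists pi', pi' ∈ PW /\ stage h pi' /\ (forall y, y ∈ R -> dm pi' y -> dm pi y) /\
    decided h pi' m K.
Proof.
  intros Hh Hpi Hst MK Hm. pose proof (MR HR) as MR'.
  pose proof (stage_type_copy Hh Hpi Hst MK) as HY.
  set (Y := sep R (fun y => dm pi y /\ agree h y K)) in *.
  pose proof Hst as [S1 [S2 [S3 [S4 S5]]]].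
  assert (HYA : subset Y A).
  { intros y Hy. apply mem_sep in Hy. destruct Hy as [Hy [[i [Hi Hyi]] _]]. now apply (S3 y Hy i Hi). }
  destruct (Dec_dense Hm HY HYA) as [C [HC [HCY [a [Ha HDec]]]]].
  pose proof HC as HC'. apply (mem_copies HM HR) in HC'.
  destruct HC' as [MC [HCR [g [Mg [G1 [G2 G3]]]]]].
  (* A vertex [y] survives when its label [i] is also the label of some [d] in [C], and its new
     label is the image of [d] under [g]. *)
  pose (pi' := sep (prod R R) (fun z => exists y, y ∈ R /\ exists r, r ∈ R /\ z = opair y r /\
    exists i, i ∈ R /\ opair y i ∈ pi /\ exists d, d ∈ C /\ opair d i ∈ pi /\ opair d r ∈ g)).
  assert (Hpi' : forall y r, opair y r ∈ pi' <-> y ∈ R /\ r ∈ R /\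
    exists i, i ∈ R /\ opair y i ∈ pi /\ exists d, d ∈ C /\ opair d i ∈ pi /\ opair d r ∈ g).
  { intros y r. unfold pi'. rewrite mem_sep, opair_prod. split.
    - intros [_ [y' [Hy [r' [Hr [Ez H]]]]]]. apply opair_inj in Ez. destruct Ez as [-> ->]. auto.
    - intros [Hy [Hr H]]. split; auto. exists y. split; auto. exists r. auto. }
  assert (HYu : forall y y' i, y ∈ Y -> y' ∈ Y -> i ∈ R -> opair y i ∈ pi -> opair y' i ∈ pi -> y = y').
  { intros y y' i Hy Hy' Hi H1 H2. apply mem_sep in Hy, Hy'.
    destruct Hy as [Hy [_ Hk]], Hy' as [Hy' [_ Hk']].
    apply (S4 y Hy i Hi H1 y' Hy' i Hi H2); auto.
    intros b Hb Hr. rewrite (Hk b Hb Hr), (Hk' b Hb Hr). tauto. }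
  exists pi'. split; [|split; [|split]].
  - pose proof (M_PW Hpi). apply PW_sep. dfs.
  - split; [|split; [|split; [|split]]]; auto.
    + intros y Hy r Hr H. apply Hpi' in H. destruct H as [_ [_ [i [Hi [H _]]]]]. eauto.
    + intros y Hy r Hr H y' Hy' r' Hr' H'. apply Hpi' in H, H'.
      destruct H as [_ [_ [i [Hi [Hyi [d [Hd [Hdi Hdr]]]]]]]].
      destruct H' as [_ [_ [i' [Hi' [Hyi' [d' [Hd' [Hdi' Hdr']]]]]]]].
      destruct (S4 y Hy i Hi Hyi y' Hy' i' Hi' Hyi') as [T1 [T2 T3]].
      destruct (S4 d (HCR _ Hd) i Hi Hdi d' (HCR _ Hd') i' Hi' Hdi') as [D1 [D2 _]].
      destruct (G3 d Hd r Hr d' Hd' r' Hr' Hdr Hdr') as [F1 F2].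
      assert (Hid : i = i' -> d = d').
      { intros <-. apply (HYu d d' i); auto. }
      split; [|split].
      * intros Hyy. apply F1, Hid, T1, Hyy.
      * intros Hrr. assert (Hii : i <> i') by (intros Hii; apply Hrr, F1, Hid, Hii).
        rewrite <- F2, (T2 Hii), (D2 Hii). tauto.
      * intros Hrr. apply T3, D1, F1, Hrr.
    + intros K' MK' r Hr. destruct (G2 r Hr) as [d [Hd Hdr]].
      pose proof (HCY d Hd) as HdY. apply mem_sep in HdY. destruct HdY as [_ [[i [Hi Hdi]] _]].
      destruct (S5 K' MK' i Hi) as [y [Hy [Hyi Hk]]]. exists y. split; auto. split; auto.
      apply Hpi'. split; auto. split; auto. exists i. split; auto. split; auto. exists d. auto.
  - intros y Hy [r [Hr H]]. apply Hpi' in H. destruct H as [_ [_ [i [Hi [H _]]]]]. exists i. auto.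
  (* A surviving vertex of the type coded by [K] shares type and label with a vertex of [C], hence
     equals it. So [C'] is contained in [C] and inherits its decision. *)
  - exists a. split; auto. intros C' HC' HCy. apply (@Dec_mono C); auto.
    intros y Hy. destruct (HCy y Hy) as [[r [Hr Hyr]] Hk]. apply Hpi' in Hyr.
    destruct Hyr as [HyR [_ [i [Hi [Hyi [d [Hd [Hdi _]]]]]]]].
    replace y with d; auto. apply (HYu d y i); auto. apply mem_sep. split; auto. split; auto.
    exists i. auto.
Qed.

(** Each new element doubles the list of codes, by its addition and by its removal. The resulting
    finite list of sets of M represents every type over [l], so finitely many shrinkings suffice at
    each stage. *)
Lemma finite_subset_codes (l : list U) : (forall b, In b l -> M b) ->
  exists Ks, (forall K, In K Ks -> M K) /\
    forall k : U -> Prop, exists K, In K Ks /\ forall b, In b l -> (b ∈ K <-> k b).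
Proof.
  induction l as [|b l IH]; intros Hl.
  - exists (num 0 :: nil). split; [intros K [<-|[]]; in_M|].
    intros k. exists (num 0). simpl. split; [auto|tauto].
  - destruct IH as [Ks [MKs HKs]]; [intros; apply Hl; simpl; auto|].
    assert (Mb : M b) by (apply Hl; simpl; auto).
    exists (map (fun K => bigcup (upair K (sing b))) Ks ++ map (fun K => sep K (fun x => x <> b)) Ks).
    split.
    + intros K HK. apply in_app_or in HK. destruct HK as [HK|HK];
      apply in_map_iff in HK; destruct HK as [K' [<- HK']]; pose proof (MKs _ HK'); [in_M|].
      apply (M_sep HM); auto. dfs.
    + intros k. destruct (HKs k) as [K [HK Hk]]. destruct (classic (k b)) as [Hb|Hb].
      * exists (bigcup (upair K (sing b))). split.
        { apply in_or_app. left. now apply (in_map (fun K => bigcup (upair K (sing b)))). }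
        intros x Hx. rewrite mem_bigcup. split.
        -- intros [y [Hy Hxy]]. apply mem_upair in Hy. destruct Hy as [->| ->].
           ++ destruct Hx as [<-|Hx]; auto. now apply Hk.
           ++ apply mem_sing in Hxy. now subst.
        -- intros Hkx. destruct (classic (x = b)) as [->|Hxb].
           ++ exists (sing b). rewrite mem_upair, mem_sing. auto.
           ++ exists K. rewrite mem_upair. split; auto. destruct Hx as [->|Hx]; [tauto|]. now apply Hk.
      * exists (sep K (fun x => x <> b)). split.
        { apply in_or_app. right. now apply (in_map (fun K => sep K (fun x => x <> b))). }
        intros x Hx. rewrite mem_sep. split.
        -- intros [HxK Hxb]. destruct Hx as [->|Hx]; [tauto|]. now apply Hk.
        -- intros Hkx. assert (Hxb : x <> b) by (intros ->; auto). split; auto.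
           destruct Hx as [->|Hx]; [tauto|]. now apply Hk.
Qed.

Lemma stage_shrink_all h pi m (l : list U) : h ∈ PW -> pi ∈ PW -> stage h pi -> m ∈ omega ->
  (forall b, In b l -> M b) -> (forall b, b ∈ R -> rg h b -> In b l) ->
  exists pi', pi' ∈ PW /\ stage h pi' /\ (forall y, y ∈ R -> dm pi' y -> dm pi y) /\
    forall K, M K -> decided h pi' m K.
Proof.
  intros Hh Hpi Hst Hm Ml Hl. pose proof (MR HR) as MR'.
  destruct (finite_subset_codes Ml) as [Ks [MKs HKs]].
  assert (HKs' : exists pi', pi' ∈ PW /\ stage h pi' /\ (forall y, y ∈ R -> dm pi' y -> dm pi y) /\
    forall K, In K Ks -> decided h pi' m K).
  { clear HKs. induction Ks as [|K Ks IH].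
    - exists pi. split; auto. split; auto. split; auto. intros K [].
    - destruct IH as [pi1 [H1 [H2 [H3 H4]]]]; [intros; apply MKs; simpl; auto|].
      destruct (@stage_shrink h pi1 K m) as [pi2 [H5 [H6 [H7 H8]]]]; auto; [apply MKs; simpl; auto|].
      exists pi2. split; auto. split; auto. split; auto.
      intros K' [<-|HK']; auto. apply decided_weaken with pi1; auto. }
  destruct HKs' as [pi' [H1 [H2 [H3 H4]]]]. exists pi'. split; auto. split; auto. split; auto.
  intros K MK. destruct (HKs (fun b => b ∈ K)) as [K0 [HK0 Hk]].
  destruct (H4 K0 HK0) as [a [Ha H]]. exists a. split; auto. intros C HC HCy. apply H; auto.
  intros y Hy. destruct (HCy y Hy) as [Hd Hag]. split; auto. intros b Hb Hr.
  rewrite (Hag b Hb Hr), (Hk b); [tauto|auto].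
Qed.

Lemma stage_split h pi x : h ∈ PW -> pi ∈ PW -> stage h pi -> x ∈ R -> ~ dm h x ->
  exists b h' pi', b ∈ R /\ h' ∈ PW /\ pi' ∈ PW /\ stage h' pi' /\ extends h pi h' pi' /\
    forall z, z ∈ h' <-> z ∈ h \/ z = opair x b.
Proof.
  intros Hh Hpi Hst Hx Hxh. pose proof (MR HR) as MR'. pose proof (ME HR) as ME'.
  destruct (twin_exists HM HR) as [i0 [tw [Hi0 [Mtw [W1 [W2 W3]]]]]].
  pose proof Hst as [S1 [S2 [S3 [S4 S5]]]].
  (* The type over the range of [h] that the image of [x] must have. The image [b] is taken of this
     type with label [i0], the vertex that separates the two twinned families. *)
  pose (K0 := sep R (fun b => exists x', x' ∈ R /\ opair x' b ∈ h /\ x ~ x')).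
  pose proof (M_PW Hh) as Mh. pose proof (M_PW Hpi) as Mpi. pose proof (M_trans HM MR' Hx) as Mx.
  assert (MK0 : M K0) by (apply (M_sep HM); auto; dfs).
  destruct (S5 K0 MK0 i0 Hi0) as [b [Hb [Hbi Hbk]]].
  destruct (S3 b Hb i0 Hi0 Hbi) as [HbA Hbh].
  pose proof (M_trans HM MR' Hb) as Mb.
  pose (h' := sep (prod R R) (fun z => z ∈ h \/ z = opair x b)).
  (* Only vertices whose old label occurs in [tw] survive. As [i0] does not occur, [b] leaves the
     pool together with the vertices of other types that share its label. *)
  pose (pi' := sep (prod R R) (fun z => exists y, y ∈ R /\ exists r, r ∈ R /\ z = opair y r /\
    exists i, i ∈ R /\ opair y i ∈ pi /\ opair i r ∈ tw)).
  assert (Eh : forall z, z ∈ h' <-> z ∈ h \/ z = opair x b).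
  { intros z. unfold h'. rewrite mem_sep. split; [tauto|]. intros H. split; auto.
    destruct H as [H| ->]; [|now apply opair_prod]. apply mem_powM in Hh. now apply Hh. }
  assert (Epi : forall y r, opair y r ∈ pi' <-> y ∈ R /\ r ∈ R /\
    exists i, i ∈ R /\ opair y i ∈ pi /\ opair i r ∈ tw).
  { intros y r. unfold pi'. rewrite mem_sep, opair_prod. split.
    - intros [_ [y' [Hy [r' [Hr [Ez H]]]]]]. apply opair_inj in Ez. destruct Ez as [-> ->]. auto.
    - intros [Hy [Hr H]]. split; auto. exists y. split; auto. exists r. auto. }
  assert (Erg : forall b', rg h' b' <-> rg h b' \/ b' = b).
  { intros b'. split.
    - intros [x' [Hx' H]]. apply Eh in H. destruct H as [H|H]; [left; exists x'; auto|].
      right. apply opair_inj in H. tauto.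
    - intros [[x' [Hx' H]]| ->]; [exists x'|exists x]; rewrite Eh; auto. }
  (* The twinning makes adjacency to [b] depend on the old label alone, uniformly in all types over
     the range of [h]. *)
  assert (Eb : forall y i, y ∈ R -> i ∈ R -> opair y i ∈ pi -> i <> i0 -> (y ~ b <-> i ~ i0)).
  { intros y i Hy Hi Hyi Hne. apply (S4 y Hy i Hi Hyi b Hb i0 Hi0 Hbi). auto. }
  assert (Hnew : forall x' b', x' ∈ R -> b' ∈ R -> opair x' b' ∈ h ->
     (x = x' <-> b = b') /\ (x ~ x' <-> b ~ b')).
  { intros x' b' Hx' Hb' H. split.
    - split; intros <-; exfalso; [apply Hxh; exists b'; auto|apply Hbh; exists x'; auto].
    - rewrite (Hbk b' Hb') by (exists x'; auto). unfold K0. rewrite mem_sep. split.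
      + intros Hadj. split; auto. exists x'. auto.
      + intros [_ [x2 [Hx2 [H2 Hadj]]]]. replace x' with x2; auto.
        now apply (S1 x2 Hx2 b' Hb' H2 x' Hx' b' Hb' H). }
  exists b, h', pi'. split; auto. split; [apply PW_sep; dfs|]. split; [apply PW_sep; dfs|].
  split; [|split; [split; [|split]|]]; auto.
  - split; [|split; [|split; [|split]]].
    + intros x1 Hx1 b1 Hb1 H1 x2 Hx2 b2 Hb2 H2. apply Eh in H1, H2.
      destruct H1 as [H1|H1], H2 as [H2|H2]; auto.
      * apply opair_inj in H2. destruct H2 as [-> ->].
        destruct (Hnew x1 b1 Hx1 Hb1 H1) as [[N1 N2] N3].
        rewrite (adj_sym HR x1 x), (adj_sym HR b1 b). split; [split; intros; symmetry; auto|exact N3].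
      * apply opair_inj in H1. destruct H1 as [-> ->]. auto.
      * apply opair_inj in H1, H2. destruct H1 as [-> ->], H2 as [-> ->].
        split; [tauto|]. split; intros Hadj; exfalso; eapply (adj_irrefl HR); eauto.
    + intros x1 Hx1 b1 Hb1 H1. apply Eh in H1. destruct H1 as [H1|H1]; [eauto|].
      apply opair_inj in H1. now destruct H1 as [-> ->].
    + intros y Hy r Hr H. apply Epi in H. destruct H as [_ [_ [i [Hi [Hyi Hir]]]]].
      destruct (S3 y Hy i Hi Hyi) as [HyA Hyh]. split; auto. rewrite Erg. intros [Hy'| ->]; auto.
      apply (W1 _ _ Hir). now apply (S4 b Hb i Hi Hyi b Hb i0 Hi0 Hbi).
    + intros y Hy r Hr H y' Hy' r' Hr' H'. apply Epi in H, H'.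
      destruct H as [_ [_ [i [Hi [Hyi Hir]]]]]. destruct H' as [_ [_ [i' [Hi' [Hyi' Hir']]]]].
      destruct (S4 y Hy i Hi Hyi y' Hy' i' Hi' Hyi') as [T1 [T2 T3]].
      destruct (W2 _ _ _ _ Hir Hir') as [D1 [D2 D3]].
      split; [auto|split].
      * intros Hrr. assert (Hii : i <> i') by auto. rewrite (T2 Hii), (D2 Hrr). tauto.
      * intros Hrr Hty. apply T3.
        -- apply D3; auto. rewrite <- (Eb y i), <- (Eb y' i'); auto.
           ++ apply Hty; auto. apply Erg; auto.
           ++ apply (W1 _ _ Hir').
           ++ apply (W1 _ _ Hir).
        -- intros b' Hb' Hr'b. apply Hty; auto. apply Erg; auto.
    (* Among the two old labels twinned under the new label [r], the one on the side of [i0]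
       prescribed by whether [b] is in [K] is used. *)
    + intros K MK r Hr. destruct (W3 r (b ∈ K) Hr) as [i [Hir He]].
      destruct (W1 _ _ Hir) as [Hi [_ Hne]].
      destruct (S5 K MK i Hi) as [y [Hy [Hyi Hk]]]. exists y. split; auto. split.
      * apply Epi. split; auto. split; auto. exists i. auto.
      * intros b' Hb' Hrb. apply Erg in Hrb. destruct Hrb as [Hrb| ->]; auto.
        rewrite (Eb y i); auto.
  - intros z Hz. apply Eh. auto.
  - intros x1 Hx1 b1 Hb1 H1. apply Eh in H1. destruct H1 as [H1|H1]; auto.
    apply opair_inj in H1. destruct H1 as [-> ->]. right. exists i0. auto.
  - intros y Hy [r [Hr H]]. apply Epi in H. destruct H as [_ [_ [i [Hi [Hyi _]]]]]. exists i. auto.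
Qed.

(** The outcome of the fusion stripped of its stages. [C] must avoid the vertices coded below [k],
    for the pool of a stage excludes the range of its embedding. *)
Definition decided_by_type B n k K a := forall C, C ∈ PR -> subset C B ->
  (forall y, y ∈ C -> forall b, b ∈ R -> below_code c b k -> y <> b /\ (y ~ b <-> b ∈ K)) ->
  opair C (opair n a) ∈ Dec.

Lemma list_code_bound (l : list U) :
  exists k, forall b, b ∈ R -> In b l -> below_code c b (num k).
Proof.
  induction l as [|b l [k Hk]].
  - exists 0. intros b _ [].
  - destruct (classic (b ∈ R)) as [Hb|Hb].
    + destruct (c_total Hb) as [n Hn]. exists (Nat.max k (S n)). intros b' Hb' [<-|Hin].
      * exists (num n). split; auto. apply num_lt. lia.
      * destruct (Hk b' Hb' Hin) as [m [Hm Hbm]]. exists m. split; auto.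
        apply mem_num in Hm. destruct Hm as [j [Hj ->]]. apply num_lt. lia.
    + exists k. intros b' Hb' [<-|Hin]; [tauto|auto].
Qed.

(** Step n decides the value at n for every type over the current range and puts the vertex with
    code n into the domain. The embeddings then unite to an isomorphism of R onto [B]. *)
Theorem fusion : exists B, B ∈ PR /\ subset B A /\
  forall n, n ∈ omega -> exists k, k ∈ omega /\ forall K, M K ->
    exists a, a ∈ kappa /\ decided_by_type B n k K a.
Proof.
  pose proof (MR HR) as MR'. pose proof (ME HR) as ME'.
  pose proof (copy_M HM HR HA) as MA. pose proof (copy_sub HM HR HA) as HAR.
  pose proof (M_copies HM HR) as MPR.
  assert (MPW : M PW) by in_M.
  (* The decision is taken relative to the old range, before it grows. The bound of one new pair per
     step is the definable trace of finiteness, which [Inv] turns into a list. *)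
  pose (step := fun m h pi h' pi' => stage h' pi' /\ extends h pi h' pi' /\
    (exists x, x ∈ R /\ exists b, b ∈ R /\ forall z, z ∈ h' -> z ∈ h \/ z = opair x b) /\
    (forall x, x ∈ R -> opair x m ∈ c -> dm h' x) /\
    (forall K, M K -> decided h pi' m K)).
  pose (Q := fun m s t => exists h, h ∈ PW /\ exists pi, pi ∈ PW /\ exists h', h' ∈ PW /\
    exists pi', pi' ∈ PW /\ (s = opair h pi /\ t = opair h' pi' /\ step m h pi h' pi')).
  pose (Inv := fun s => exists h pi, s = opair h pi /\ stage h pi /\
    exists l, (forall b, In b l -> M b) /\ forall b, b ∈ R -> rg h b -> In b l).
  assert (Hinit : exists s0, s0 ∈ prod PW PW /\ Inv s0).
  { pose proof HA as HA'. apply (mem_copies HM HR) in HA'. destruct HA' as [_ [_ [f [Mf [F1 [F2 F3]]]]]].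
    (* Over the empty range there is a single type, and an isomorphism of [A] onto R serves as its
       labelling. *)
    pose (pi := sep (prod R R) (fun z => z ∈ prod A R /\ z ∈ f)).
    assert (Hpi : forall y i, opair y i ∈ pi <-> y ∈ A /\ i ∈ R /\ opair y i ∈ f).
    { intros y i. unfold pi. rewrite mem_sep, !opair_prod. split; [tauto|].
      intros [H1 [H2 H3']]. auto. }
    assert (Hno : forall b, ~ rg emp b) by (intros b [x [_ Hx]]; now apply mem_emp in Hx).
    exists (opair emp pi). split.
    - apply opair_prod. split.
      + apply mem_powM. split; [exact (M_num HM 0)|]. intros z Hz. now apply mem_emp in Hz.
      + apply PW_sep. dfs.
    - exists emp, pi. split; auto. split; [|exists nil; split; [intros b []|intros b _ Hb; now apply Hno in Hb]].
      split; [|split; [|split; [|split]]].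
      + intros x _ b _ Hx. now apply mem_emp in Hx.
      + intros x _ b _ Hx. now apply mem_emp in Hx.
      + intros y _ i _ Hy. apply Hpi in Hy. split; [tauto|auto].
      + intros y _ i _ H1 y' _ i' _ H2. apply Hpi in H1, H2.
        destruct H1 as [Hy [Hi H1]], H2 as [Hy' [Hi' H2]].
        destruct (F3 y Hy i Hi y' Hy' i' Hi' H1 H2) as [T1 T2].
        split; [tauto|]. split; [tauto|]. intros Hii _. now apply T1.
      + intros K _ i Hi. destruct (F2 i Hi) as [y [Hy Hyi]]. exists y. split; auto.
        split; [now apply Hpi|]. intros b _ Hb. now apply Hno in Hb. }
  destruct Hinit as [s0 [Hs0 Hi0]].
  destruct (@M_dependent_choice U M HM (prod PW PW) Q Inv s0) as [g [_ [Hg [F [MF HF]]]]]; auto.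
  - in_M.
  - unfold Q, step, stage, extends, decided. dfs.
  - intros n s Hs [h [pi [-> [Hst [l [Ml Hl]]]]]]. apply opair_prod in Hs. destruct Hs as [Hh Hpi].
    destruct (stage_shrink_all Hh Hpi Hst (num_omega n) Ml Hl) as [pi1 [H1 [H2 [H3' H4]]]].
    assert (Hcase : (exists x, x ∈ R /\ opair x (num n) ∈ c /\ ~ dm h x) \/
       forall x, x ∈ R -> opair x (num n) ∈ c -> dm h x).
    { destruct (classic (exists x, x ∈ R /\ opair x (num n) ∈ c /\ ~ dm h x)) as [|Hno]; auto.
      right. intros x Hx Hc. apply NNPP. intros Hd. eauto. }
    destruct Hcase as [[x [Hx [Hxc Hxd]]]|Hall].
    + destruct (stage_split Hh H1 H2 Hx Hxd) as [b [h' [pi' [Hb [Hh' [Hpi' [Hst' [[X1 [X2 X3]] Hz]]]]]]]].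
      exists (opair h' pi'). split; [now apply opair_prod|].
      exists h. split; auto. exists pi. split; auto. exists h'. split; auto. exists pi'. split; auto.
      split; auto. split; auto. split; auto. split; [split; [|split]|split; [|split]]; auto.
      * intros x1 Hx1 b1 Hb1 Hin. destruct (X2 x1 Hx1 b1 Hb1 Hin); auto.
      * exists x. split; auto. exists b. split; auto. intros z Hzz. now apply Hz.
      * intros x1 Hx1 Hc1. replace x1 with x by eauto. exists b. split; auto. apply Hz. auto.
      * intros K MK. apply decided_weaken with pi1; auto.
    + exists (opair h pi1). split; [now apply opair_prod|].
      exists h. split; auto. exists pi. split; auto. exists h. split; auto. exists pi1. split; auto.
      split; auto. split; auto. split; auto. split; [split; [|split]|split; [|split]]; auto.
      (* Nothing is added to the domain here; the pair of [v] with itself only fills the clause that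
         bounds the growth. *)
      destruct (copy_nonempty HM HR HA) as [v Hv].
      exists v. split; auto. exists v. split; auto.
  - intros n s t _ _ [h0 [pi0 [-> [_ [l [Ml Hl]]]]]] [h [Hh [pi [Hpi [h' [Hh' [pi' [Hpi' [Es [-> Hstep]]]]]]]]]].
    apply opair_inj in Es. destruct Es as [-> ->].
    destruct Hstep as [Hst' [_ [[x [Hx [b [Hb Hz]]]] _]]].
    exists h', pi'. split; auto. split; auto. exists (b :: l).
    split; [intros b' [<-|Hb']; [exact (M_trans HM MR' Hb)|auto]|]. intros b' Hb' [x' [Hx' H']].
    destruct (Hz _ H') as [Hold|Hnew]; [right; apply Hl; auto; exists x'; auto|].
    left. apply opair_inj in Hnew. symmetry. tauto.
  - pose (hh := fun n => ofst (g n)). pose (pp := fun n => osnd (g n)).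
    assert (Hgn : forall n, g n = opair (hh n) (pp n) /\ hh n ∈ PW /\ pp n ∈ PW /\ stage (hh n) (pp n) /\
      exists l, forall b, b ∈ R -> rg (hh n) b -> In b l).
    { intros n. destruct (Hg n) as [Hin [[h [pi [Egn [Hst [l [_ Hl]]]]]] _]].
      unfold hh, pp. rewrite Egn, ofst_opair, osnd_opair. rewrite Egn in Hin.
      apply opair_prod in Hin. split; auto. split; [tauto|]. split; [tauto|]. eauto. }
    assert (Hstep : forall n, step (num n) (hh n) (pp n) (hh (S n)) (pp (S n))).
    { intros n. destruct (Hg n) as [_ [_ [h [_ [pi [_ [h' [_ [pi' [_ [E1 [E2 Hs]]]]]]]]]]]].
      unfold hh, pp. now rewrite E1, E2, !ofst_opair, !osnd_opair. }
    assert (Hmono : forall (n m : nat) z, n <= m -> z ∈ hh n -> z ∈ hh m).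
    { intros n m z Hnm Hz. induction Hnm as [|j Hnm IH]; auto.
      destruct (Hstep j) as [_ [[X1 _] _]]. auto. }
    assert (Hpmono : forall (n m : nat) y, n <= m -> y ∈ R -> dm (pp m) y -> dm (pp n) y).
    { intros n m y Hnm Hy. induction Hnm as [|j Hnm IH]; auto. intros Hd. apply IH.
      destruct (Hstep j) as [_ [[_ [_ X3]] _]]. auto. }
    assert (Hrg : forall (n m : nat) y, y ∈ R -> rg (hh m) y -> rg (hh n) y \/ dm (pp n) y).
    { intros n m y Hy. induction m as [|m IH]; intros [x [Hx Hxy]].
      - left. exists x. split; auto. apply (Hmono 0); auto. lia.
      - destruct (Hstep m) as [_ [[_ [X2 _]] _]].
        destruct (X2 x Hx y Hy Hxy) as [Hold|Hd]; [apply IH; exists x; auto|].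
        destruct (le_lt_dec n m) as [Hle|Hlt]; [right; eapply Hpmono; eauto|].
        left. exists x. split; auto. apply (Hmono (S m)); auto. }
    (* The union of the embeddings is inverted, as an isomorphism witnessing a copy goes from the
       copy onto R. *)
    pose (H := sep (prod R R) (fun z => exists b, b ∈ R /\ exists x, x ∈ R /\ z = opair b x /\
      exists s, s ∈ F /\ exists h, h ∈ PW /\ exists pi, pi ∈ PW /\ s = opair h pi /\ opair x b ∈ h)).
    assert (EH : forall b x, opair b x ∈ H <-> exists n, opair x b ∈ hh n).
    { intros b x. unfold H. rewrite mem_sep, opair_prod. split.
      - intros [_ [b' [_ [x' [_ [Ez [s [Hs [h [_ [pi [_ [Es Hin]]]]]]]]]]]]].
        apply opair_inj in Ez. destruct Ez as [<- <-]. apply HF in Hs. destruct Hs as [n Hs].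
        exists n. rewrite (proj1 (Hgn n)), Es in Hs.
        apply opair_inj in Hs. destruct Hs as [<- _]. auto.
      - intros [n Hin]. destruct (Hgn n) as [Egn [Hhn [Hpn _]]].
        destruct (PW_inv Hhn Hin) as [Hx Hb]. split; auto. exists b. split; auto. exists x. split; auto.
        split; auto. exists (g n). split; [apply HF; eauto|]. exists (hh n). split; auto.
        exists (pp n). auto. }
    pose (B := sep R (fun b => exists x, x ∈ R /\ opair b x ∈ H)).
    assert (MH : M H).
    { apply (M_sep HM); [in_M|]. dfs. }
    assert (EB : forall b, b ∈ B <-> exists n, rg (hh n) b).
    { intros b. unfold B. rewrite mem_sep. split.
      - intros [_ [x [Hx Hin]]]. apply EH in Hin. destruct Hin as [n Hin]. exists n, x. auto.
      - intros [n [x [Hx Hin]]]. destruct (Hgn n) as [_ [Hhn _]].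
        split; [now apply (PW_inv Hhn) in Hin|]. exists x. split; auto. apply EH. eauto. }
    exists B. split; [|split].
    + apply (mem_copies HM HR). split; [apply (M_sep HM); auto; dfs|].
      split; [intros z Hz; now apply mem_sep in Hz|]. exists H. split; auto. split; [|split].
      * intros b Hb. apply mem_sep in Hb. apply Hb.
      * intros x Hx. destruct (c_total Hx) as [n Hn].
        destruct (Hstep n) as [_ [_ [_ [Hd _]]]]. destruct (Hd x Hx Hn) as [b [Hb Hxb]].
        exists b. split; [apply EB; exists (S n), x; auto|]. apply EH. eauto.
      * intros b Hb x Hx b' Hb' x' Hx' I1 I2. apply mem_sep in Hb, Hb'. destruct Hb as [Hb _], Hb' as [Hb' _].
        apply EH in I1, I2. destruct I1 as [n1 I1], I2 as [n2 I2].
        destruct (Hgn (Nat.max n1 n2)) as [_ [_ [_ [[S1 _] _]]]].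
        destruct (S1 x Hx b Hb (Hmono _ _ _ (Nat.le_max_l n1 n2) I1)
                     x' Hx' b' Hb' (Hmono _ _ _ (Nat.le_max_r n1 n2) I2)) as [T1 T2]. tauto.
    + intros b Hb. apply EB in Hb. destruct Hb as [n [x [Hx Hin]]].
      destruct (Hgn n) as [_ [Hhn [_ [[_ [S2 _]] _]]]]. destruct (PW_inv Hhn Hin). eauto.
    + intros n Hn. apply mem_omega in Hn. destruct Hn as [j ->].
      (* Types are taken over the range of [hh j], but the pool [pp (S j)] also lacks the vertex
         that step [j] may add; so [k] bounds the codes of the range of [hh (S j)]. *)
      destruct (Hgn (S j)) as [_ [_ [_ [_ [l Hl]]]]]. destruct (list_code_bound l) as [k Hk].
      exists (num k). split; [apply num_omega|]. intros K MK.
      destruct (Hstep j) as [_ [[X1 _] [_ [_ Hdec]]]].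
      destruct (Hdec K MK) as [a [Ha Hd]]. exists a. split; auto.
      intros C HC HCB Hty. apply Hd; auto. intros y Hy.
      pose proof (copy_sub HM HR HC Hy) as HyR. split.
      * pose proof (HCB y Hy) as HyB. apply EB in HyB. destruct HyB as [m Hm].
        (* A vertex of [C] in the range of [hh (S j)] would have a code below [k] and would then
           have to differ from itself. *)
        destruct (Hrg (S j) m y HyR Hm) as [Hr|]; auto. exfalso.
        destruct (Hty y Hy y HyR (Hk y HyR (Hl y HyR Hr))) as [Hne _]. auto.
      * intros b Hb [x [Hx Hxb]]. apply (Hty y Hy b Hb). apply Hk; auto. apply Hl; auto.
        exists x. auto.
Qed.

End Fusion.

(** * Types read off rho_G, and the computation of x from it *)

Lemma rho_type (U : universe) (V : U -> Prop) (HV : transitive_model V) (R E : U)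
  (HR : is_rado V R E) (G : U) (HG : is_generic V (copies V R E) subset G) (B : U) (l : list U) :
  B ∈ G -> (forall b, In b l -> b ∈ R) ->
  exists C, C ∈ G /\ subset C B /\
    forall v b, v ∈ C -> In b l -> v <> b /\ (opair v b ∈ E <-> b ∈ rho R E G).
Proof.
  intros HB. pose proof (M_copies HV HR) as MP. induction l as [|b l IH]; intros Hl.
  - exists B. split; auto. split; [intros z; auto|]. intros v b _ [].
  - destruct IH as [C [HC [HCB HCl]]]; [intros; apply Hl; simpl; auto|].
    assert (Hb : b ∈ R) by (apply Hl; simpl; auto).
    pose proof (nbhd_copy HV HR Hb) as HN. pose proof (copy_M HV HR HN) as MN.
    pose proof (M_trans HV (MR HR) Hb) as Mb.
    (* By indivisibility, densely many conditions miss [b] and lie wholly inside or wholly outside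
       its neighbourhood. In the first case the neighbourhood belongs to [G] by upward closure; in
       the second it cannot, being incompatible with a member of [G]. *)
    destruct (@generic_below U V HV _ MP G HG C (fun D => b ∉ D /\
      ((forall v, v ∈ D -> v ∈ nbhd R E b) \/ forall v, v ∈ D -> v ∉ nbhd R E b)))
      as [D [HD [HbD HDN]]]; auto.
    + dfs.
    + intros D HD _. destruct (copy_avoid HV HR HD Hb) as [D1 [HD1 [H1 Hb1]]].
      destruct (copy_indivisible HV HR HD1 MN) as [D2 [HD2 [H2 H3]]].
      exists D2. split; auto. split; [intros z Hz; auto|]. split; auto.
    + destruct (G_common HG HC HD) as [D' [HD' [H1 H2]]]. exists D'. split; auto.
      split; [intros z Hz; auto|].
      intros v a Hv [<-|Ha]; [|apply HCl; auto].
      assert (HvR : v ∈ R) by exact (copy_sub HV HR (G_sub HG HD') Hv).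
      assert (Hvb : v <> b) by (intros ->; auto). split; auto.
      assert (Hrho : b ∈ rho R E G <-> nbhd R E b ∈ G) by (unfold rho; rewrite mem_sep; tauto).
      rewrite Hrho. destruct HDN as [Hin|Hout].
      * assert (HNG : nbhd R E b ∈ G) by (apply (filter_up (proj1 HG) HD); auto).
        pose proof (Hin v (H2 v Hv)) as Hvn. apply mem_nbhd in Hvn. tauto.
      * split.
        -- intros Hadj. exfalso. apply (Hout v (H2 v Hv)). apply mem_nbhd. auto.
        -- intros HNG. exfalso. destruct (G_common HG HD HNG) as [r [Hr [Hr1 Hr2]]].
           destruct (copy_nonempty HV HR (G_sub HG Hr)) as [w Hw].
           apply (Hout w); auto.
Qed.

Unset Implicit Arguments.

Theorem theorem6p2 (U : universe) (V : U -> Prop) (HV : transitive_model V)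
    (R E : U) (HR : is_rado V R E)
    (kappa : U) (Hkappa : is_infinite_cardinal V kappa)
    (G : U) (HG : is_generic V (copies V R E) subset G)
    (x : U) (Hx : gen_ext V (copies V R E) G x)
    (Hfun : is_function x omega kappa) :
  adjoin V (rho R E G) x.
Proof.
  pose proof (M_copies HV HR) as MP. pose proof (MR HR) as MR'. pose proof (ME HR) as ME'.
  pose proof (proj1 Hkappa) as Mk.
  destruct Hx as [t [Mt [_ Hval]]].
  destruct (decisions_exist HV MP HG Mk Mt Hval Hfun) as [Dec [MDec [Hmono [Hsound [A [HA Hdense]]]]]].
  destruct (code_exists HR) as [c [Mc [Hc1 [Hc2 Hc3]]]].
  pose (dbt := decided_by_type V R E c Dec).
  destruct (@generic_below U V HV _ MP G HG A (fun B =>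
    forall n, n ∈ omega -> exists k, k ∈ omega /\ forall K, V K ->
    exists a, a ∈ kappa /\ dbt B n k K a)) as [B [HB HBdec]]; auto.
  { unfold dbt, decided_by_type, below_code. dfs. }
  { intros D HD HDA.
    destruct (@fusion U V HV R E HR c Mc Hc1 Hc2 Dec kappa MDec Mk Hmono D HD) as [B [HB [HBD HBdec]]].
    - intros n Hn C HC HCD. apply Hdense; auto. intros z Hz; auto.
    - exists B. auto. }
  assert (MB : V B) by exact (M_trans HV MP (G_sub HG HB)).
  pose proof (fun k => below_code_list R k Hc2) as Hlow.
  (* If [K] agrees with rho_G on the vertices coded below [k], some condition in [G] below [B] has
     exactly the type coded by [K]; it decides the value [a], so this value is correct. *)
  assert (Htrue : forall n k K a, k ∈ omega -> dbt B n k K a ->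
    (forall b, b ∈ R -> below_code c b k -> (b ∈ K <-> b ∈ rho R E G)) -> opair n a ∈ x).
  { intros n k K a Hk Hd HK. apply mem_omega in Hk. destruct Hk as [j ->].
    destruct (Hlow j) as [l [Hl1 Hl2]].
    destruct (rho_type HV HR HG HB Hl1) as [C [HC [HCB HCl]]].
    apply (Hsound C); auto. apply Hd; auto; [exact (G_sub HG HC)|].
    intros y Hy b Hb Hbk. destruct (HCl y b Hy (Hl2 b Hb Hbk)) as [H1 H2].
    split; auto. rewrite H2. symmetry. now apply HK. }
  (* The table of all decisions, formed in V: what remains is to look up the entries at codes that
     agree with rho_G. *)
  pose (Phi := sep (prod (prod omega kappa) (prod omega (powM V R)))
    (fun z => exists n, n ∈ omega /\ exists a, a ∈ kappa /\ exists k, k ∈ omega /\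
       exists K, K ∈ powM V R /\ z = opair (opair n a) (opair k K) /\ dbt B n k K a)).
  assert (EPhi : forall n a k K, opair (opair n a) (opair k K) ∈ Phi <->
    n ∈ omega /\ a ∈ kappa /\ k ∈ omega /\ K ∈ powM V R /\ dbt B n k K a).
  { intros n a k K. unfold Phi. rewrite mem_sep, !opair_prod. split.
    - intros [_ [n' [? [a' [? [k' [? [K' [? [Ez ?]]]]]]]]]]. apply opair_inj in Ez.
      destruct Ez as [Ez1 Ez2]. apply opair_inj in Ez1, Ez2.
      destruct Ez1 as [-> ->], Ez2 as [-> ->]. auto.
    - intros [? [? [? [? ?]]]]. split; auto. exists n. split; auto. exists a. split; auto.
      exists k. split; auto. exists K. auto. }
  assert (MPhi : V Phi).
  { apply (M_sep HV); [in_M|]. assert (V (powM V R)) by in_M.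
    unfold dbt, decided_by_type, below_code. dfs. }
  intros N HN HVN Hrho.
  replace x with (sep (prod omega kappa) (fun z => exists n, n ∈ omega /\ exists a, a ∈ kappa /\
    z = opair n a /\ exists k, k ∈ omega /\ exists K, K ∈ powM V R /\
    (forall b, b ∈ R -> below_code c b k -> (b ∈ K <-> b ∈ rho R E G)) /\
    opair (opair n a) (opair k K) ∈ Phi)).
  { pose proof (HVN _ Mc). pose proof (HVN _ Mk). pose proof (HVN _ MR').
    pose proof (HVN _ MPhi). pose proof (HVN _ (M_powM HV MR')).
    apply (M_sep HN); [in_M|]. unfold below_code. dfs. }
  apply mem_ext. intros z. rewrite mem_sep. split.
  - intros [_ [n [Hn [a [Ha [-> [k [Hk [K [HK [Hag HPhi]]]]]]]]]]]. apply EPhi in HPhi.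
    apply (Htrue n k K a); tauto.
  - intros Hz. destruct Hfun as [Hf1 Hf2].
    destruct (Hf1 z Hz) as [n [a [Hn [Ha ->]]]]. split; [now apply opair_prod|].
    exists n. split; auto. exists a. split; auto. split; auto.
    destruct (HBdec n Hn) as [k [Hk HKd]]. exists k. split; auto.
    pose proof Hk as Hk'. apply mem_omega in Hk'. destruct Hk' as [j ->].
    destruct (Hlow j) as [l [Hl1 Hl2]].
    (* The trace of rho_G on the finitely many relevant vertices is a set of V, hence a legitimate
       entry of the table. *)
    destruct (M_list HV (l := l) (fun b => b ∈ rho R E G)) as [K [MK HK]].
    { intros b Hb. exact (M_trans HV MR' (Hl1 b Hb)). }
    exists K. assert (HKR : K ∈ powM V R).
    { apply mem_powM. split; auto. intros b Hb. apply HK in Hb. now apply Hl1. }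
    assert (Hag : forall b, b ∈ R -> below_code c b (num j) -> (b ∈ K <-> b ∈ rho R E G)).
    { intros b Hb Hbj. rewrite HK. specialize (Hl2 b Hb Hbj). tauto. }
    split; auto. split; auto. destruct (HKd K MK) as [a' [Ha' Hd]].
    apply EPhi. split; auto. split; auto. split; auto. split; auto.
    (* The value decided for the true type is correct, so it is the value of [x] at [n] because [x]
       is a function. *)
    replace a with a'; auto. pose proof (Htrue n (num j) K a' Hk Hd Hag) as Hx'.
    destruct (Hf2 n Hn) as [a0 [_ Hu]]. rewrite <- (Hu a), <- (Hu a'); auto.
Qed.
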